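(* Let $\Gamma$ be a finitely generated group of exponential growth, let $\mu$ be a symmetric probability law on $\Gamma$ whose support is a finite symmetric generating set $\mathcal{S}$ of $\Gamma$, and let $(A(n))_{n\ge1}$ be the Internal DLA on $\Gamma$ associated with the random walk with increment law $\mu$. Let $d$ be the hitting distance of this walk, $K=\max\{d(e,x):x\in\mathcal{S}\}$, $B(r)=\{y\in\Gamma:d(e,y)\le Kr\}$ for real $r$, and $V(n)=\#B(n)$. Then, for any constants $C_I>3/K$ and $C_O>2$, $$\mathbb{P}\left[\exists\, n_0 \text{ such that } \forall n>n_0,\; B(n-C_I\ln n)\subset A(V(n))\subset B(n+C_O\sqrt{n})\right]=1 .$$
   Context: $\Gamma$ is a finitely generated group with identity $e$, $\mathcal{S}$ is a finite symmetric generating set, $|x|$ is the word length of $x$ with respect to $\mathcal{S}$, and $V_w(n)=\#\{x\in\Gamma:|x|\le n\}$. Exponential growth means that there is a constant $c>0$ with $V_w(n)\ge \exp(cn)$ for all $n$. The law $\mu$ satisfies $\mu(s)=\mu(s^{-1})$. With $(X_k)_{k\ge1}$ i.i.d. of law $\mu$, the random walk started at $x$ is $S(0)=x$, $S(k)=xX_1X_2\cdots X_k$; its law is denoted $\mathbb{P}^x$. The hitting time of $y$ is $\tau_y=\inf\{k\ge 0: S(k)=y\}$ (with $\inf\emptyset=\infty$), $F(x,y)=\mathbb{P}^x[\tau_y<\infty]$, and the hitting distance is $d(x,y)=-\ln F(x,y)$, a left invariant distance on $\Gamma$. Internal DLA: let $(S^n(\cdot))_{n\ge1}$ be i.i.d.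 copies of the random walk, all started at $e$. Define random finite sets by $A(1)=\{e\}$ and $A(n+1)=A(n)\cup\{S^{n+1}(\tau_{A(n)^c})\}$, where $\tau_{A(n)^c}$ is the first time $k\ge 0$ at which $S^{n+1}(k)\notin A(n)$ (almost surely finite). Thus $\#A(n)=n$. The index $n$ ranges over positive integers. *)

(* Defs.v *)
From mathcomp Require Import all_boot all_order all_algebra finmap.
From mathcomp Require Import all_classical all_reals all_analysis.

Set Implicit Arguments.
Unset Strict Implicit.
Unset Printing Implicit Defensive.

Import Order.TTheory GRing.Theory Num.Theory.

Local Open Scope classical_set_scope.
Local Open Scope ring_scope.

Section Groups.
Context {G : groupType}.
Implicit Types (S : {fset G}) (x : G) (n : nat).

Definition is_word_of_size S x n : Prop :=
  exists s : seq G, [/\ size s = n, {subset s <= S} & x = \big[*%g/1%g]_(y <- s) y].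

Definition generates S : Prop := forall x, exists n, is_word_of_size S x n.

Definition symmetric_fset S : Prop := forall x, x \in S -> (x^-1)%g \in S.

(* The value 0 outside the submonoid spanned by S is junk: word_length is only
   used when S generates. *)
Definition word_length S x : nat :=
  if pselect (exists n, `[<is_word_of_size S x n>]) is left h
  then ex_minn h else 0.

Definition word_volume S n : nat :=
  #|` fset_set [set x | (word_length S x <= n)%N]|.

Definition exponential_growth (R : realType) S : Prop :=
  exists c : R, 0 < c /\
    forall n, expR (c * n%:R) <= (word_volume S n)%:R.

End Groups.

(* A finitely supported law is a finitely supported function; its support is
   the finite set [finsupp mu]. *)
Definition is_law (R : realType) (G : choiceType) (mu : {fsfun G -> R with 0}) :
    Prop :=
  (forall x, 0 <= mu x) /\ \sum_(x <- finsupp mu) mu x = 1.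

Definition symmetric_law (R : realType) (G : groupType)
    (mu : {fsfun G -> R with 0}) : Prop :=
  forall x : G, mu (x^-1)%g = mu x.

(* Values are taken in a discrete space, where every set is measurable. *)
Definition mutually_independent (d : measure_display) (Omega : measurableType d)
    (R : realType) (P : probability Omega R) (I G : choiceType)
    (X : I -> Omega -> G) : Prop :=
  forall (J : {fset I}) (A : I -> set G),
    P (\bigcap_(i in [set` J]) (X i @^-1` A i)) =
    (\prod_(i <- J) P (X i @^-1` A i))%E.

Definition iid_of_law (d : measure_display) (Omega : measurableType d)
    (R : realType) (P : probability Omega R) (I G : choiceType)
    (mu : {fsfun G -> R with 0}) (X : I -> Omega -> G) : Prop :=
  [/\ forall i (A : set G), measurable (X i @^-1` A),
      forall i x, P (X i @^-1` [set x]) = (mu x)%:E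
    & mutually_independent P X].

Section Walks.
Context {G : groupType}.

(* The increments are numbered from 0: [X k] is the (k+1)-st step. *)
Fixpoint walk (x : G) (X : nat -> G) (k : nat) : G :=
  if k is j.+1 then (walk x X j * X j)%g else x.

(* [None] stands for an infinite hitting time. *)
Definition hitting_time (path : nat -> G) (C : set G) : option nat :=
  if pselect (exists k, path k \in C) is left h then Some (ex_minn h) else None.

(* The set A(n) built from the trajectories [S n], n >= 1; A(0) and [S 0] play
   no role. Nothing is added if a trajectory never leaves A(n). *)
Fixpoint internal_DLA (S : nat -> nat -> G) (n : nat) : set G :=
  match n with
  | 0 => set0
  | 1 => [set 1%g]
  | m.+1 =>
      let A := internal_DLA S m in
      A `|` (if hitting_time (S m.+1) (~` A) is Some k
             then [set S m.+1 k] else set0)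
  end.

End Walks.

Section HittingDistance.
Context {d : measure_display} {Omega : measurableType d} {R : realType}.
Context {G : groupType}.
Context (P : probability Omega R) (Y : nat -> Omega -> G).

Definition hitting_probability (x y : G) : R :=
  fine (P [set w | hitting_time (walk x (Y^~ w)) [set y] != None]).

(* [ln 0] is junk, but hitting probabilities are positive as soon as the steps
   charge a symmetric generating set. *)
Definition hitting_distance (x y : G) : R := - ln (hitting_probability x y).

(* Hitting distances are nonnegative, so 0 is a neutral default value. *)
Definition max_step_distance (S : {fset G}) : R :=
  \big[Num.max/0]_(x <- S) hitting_distance 1%g x.

Definition hitting_ball (S : {fset G}) (r : R) : set G :=
  [set y | hitting_distance 1%g y <= max_step_distance S * r].

(* [fset_set] of an infinite set is empty; under exponential growth the balls
   are finite. *)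
Definition ball_volume (S : {fset G}) (n : nat) : nat :=
  #|` fset_set (hitting_ball S n%:R)|.

End HittingDistance.

(* Main.v *)
Require Import Defs.
From mathcomp Require Import all_boot all_order all_algebra finmap.
From mathcomp Require Import all_classical all_reals all_analysis.
From mathcomp Require Import ring lra zify.

(* Write F for hitting probabilities, so that B(r) = {y : F(e,y) >= exp(-Kr)}.

   Volume. Let f be a nonnegative function of finite support with f - Pf at
   most the indicator of e (a truncated Green function). The flux of f out of
   a level set {f > s} is at most 1, while exponential growth forces a set of
   size v to have at least c v / ln v boundary edges. Lowering s by
   C ln v / v therefore multiplies v by 1 + c / ln v, and iterating gives
   s #{f > s} <= C (4 + ln #{f > s})^2. Hence the Green function is bounded
   and #B(n) <= C (1 + Kn)^2 exp(Kn). Conversely the walk leaves B(n) through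
   B(n+1) \ B(n), whose points are hit with probability less than exp(-Kn), so
   #B(n+1) >= exp(Kn).

   Inner bound. For z in B(r), r < n, the function
   f(y) = max(F(y,z) - exp(-Kn), 0) is subharmonic away from z, so as long as
   z is not in the cluster each new particle settles at a point where f is on
   average at least f(e). As the sum of f over any finite set is at most
   sum_{B(n)} F(e,.) = O(n^3), an exponential moment shows that z is missed by
   A(N) with probability at most exp(O(n^3) - N f(e) / 4), and for N = #B(n)
   and r = n - C_I ln n the product N f(e) is of order n^(K C_I).

   Outer bound. A particle settling outside B(n+k+1) has visited a cluster
   point outside B(n+k), which has probability at most exp(-K(n+k)) times the
   number of such points. Iterating, the expected number of points of A(N)
   outside B(n+k) is at most N prod_{i<k} (N exp(-K(n+i))).

   All expectations are taken over finite words: the particles are stopped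
   after T steps, and for each outcome the truncated cluster agrees with the
   true one for T large. *)

Set Implicit Arguments.
Unset Strict Implicit.
Unset Printing Implicit Defensive.

Import Order.TTheory GRing.Theory Num.Theory.

Local Open Scope classical_set_scope.
Local Open Scope ring_scope.

(** * Isoperimetry *)

Section Isoperimetry.
Context {G : groupType}.
Implicit Types (D W S : {fset G}) (g h x : G).

Definition exits D g : nat := count (fun x => (x * g)%g \notin D) D.

Lemma exits1 D : exits D 1%g = 0.
Proof.
apply/eqP; rewrite /exits -leqn0 leqNgt -has_count; apply/hasPn => x xD.
by rewrite mulg1 negbK.
Qed.

Lemma exitsM D g h : (exits D (g * h)%g <= exits D g + exits D h)%N.
Proof.
rewrite /exits.
have sub : {subset [seq (x * g)%g | x <- D & ((x * g)%g \in D) && ((x * (g * h))%g \notin D)]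
   <= [seq y <- D | (y * h)%g \notin D]}.
  move=> y /mapP[x]; rewrite mem_filter => /andP[/andP[xg xgh] _] ->.
  by rewrite mem_filter xg -mulgA xgh.
have := uniq_leq_size _ sub; rewrite map_inj_uniq; last exact: mulIg.
rewrite filter_uniq ?fset_uniq // => /(_ isT); rewrite size_map !size_filter => le2.
apply: leq_trans (leq_add (leqnn _) le2).
rewrite -count_predUI; apply: leq_trans (leq_addr _ _).
apply: sub_count => x /= xgh; rewrite xgh andbT.
by case: ((x * g)%g \in D).
Qed.

Lemma exits_prod D (w : seq G) :
  (exits D (\big[*%g/1%g]_(y <- w) y) <= \sum_(s <- w) exits D s)%N.
Proof.
elim: w => [|s w IHw]; first by rewrite !big_nil exits1.
by rewrite !big_cons; apply: leq_trans (exitsM _ _ _) _; rewrite leq_add2l.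
Qed.

Lemma exists_exits D W : (0 < #|` D|)%N -> (2 * #|` D| <= #|` W|)%N ->
  exists2 g, g \in W & (#|` D| <= 2 * exits D g)%N.
Proof.
move=> D0 DW; apply: contrapT => noW.
have stay g : g \in W -> (#|` D| < 2 * count (fun x => (x * g)%g \in D) D)%N.
  move=> gW; have lt : (2 * exits D g < #|` D|)%N.
    by rewrite ltnNge; apply/negP => le; apply: noW; exists g.
  have : (count (fun x => (x * g)%g \in D) D + exits D g = #|` D|)%N.
    exact: count_predC.
  by move: lt; move: (exits D g) #|` D| (count _ _) => a b k; lia.
have swap : (\sum_(g <- W) count (fun x => (x * g)%g \in D) D <= #|` D| * #|` D|)%N.
  under eq_bigr do rewrite -sum1_count big_mkcond /=.
  rewrite exchange_big /=.
  have -> : (#|` D| * #|` D| = \sum_(x <- D) #|` D|)%N.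
    by rewrite big_const_seq count_predT iter_addn_0.
  apply: leq_sum => x _; rewrite -big_mkcond sum1_count -size_filter.
  have sub : {subset [seq (x * g)%g | g <- W & (x * g)%g \in D] <= D}.
    by move=> y /mapP[g]; rewrite mem_filter => /andP[xg _] ->.
  have := uniq_leq_size _ sub; rewrite map_inj_uniq; last exact: mulgI.
  by rewrite filter_uniq ?fset_uniq // size_map => /(_ isT).
have : (\sum_(g <- W) (#|` D|.+1) <= 2 * \sum_(g <- W) count (fun x => (x * g)%g \in D) D)%N.
  by rewrite big_distrr /= big_seq [X in (_ <= X)%N]big_seq; apply: leq_sum => g /stay.
rewrite big_const_seq count_predT iter_addn_0.
move: swap D0 DW; set a := #|` D|; set b := #|` W|; set c := \sum_(_ <- _) _.
nia.
Qed.

Lemma word_ball_word S r g : g \in fset_set [set x | (word_length S x <= r)%N] ->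
  generates S -> exists w : seq G,
  [/\ (size w <= r)%N, {subset w <= S} & g = \big[*%g/1%g]_(y <- w) y].
Proof.
move=> gW gen.
have fin : finite_set [set x | (word_length S x <= r)%N].
  apply: contrapT => inf; move: gW; rewrite /fset_set; case: pselect => //.
move: gW; rewrite in_fset_set // inE /= /word_length.
case: pselect => [h|]; last by case: (gen g) => n gn []; exists n; apply/asboolP.
by case: ex_minnP => n /asboolP[w [sw wS gE]] _ nr; exists w; rewrite sw.
Qed.

Lemma isoperimetry (R : realType) S (c : R) :
  generates S -> (forall n, expR (c * n%:R) <= (word_volume S n)%:R) ->
  forall D r, (0 < #|` D|)%N -> (2 * #|` D|)%:R <= expR (c * r%:R) ->
  exists2 s, s \in S & (#|` D| <= 2 * r * exits D s)%N.
Proof.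
move=> gen growth D r D0 Dr.
have /exists_exits : (2 * #|` D| <= word_volume S r)%N.
  by rewrite -(ler_nat R); exact: le_trans Dr (growth r).
case=> // g /word_ball_word/(_ gen)[w [sw wS ->]] Dg.
apply: contrapT => noS.
have lt s : s \in S -> (2 * r * exits D s < #|` D|)%N.
  by move=> sS; rewrite ltnNge; apply/negP => le; apply: noS; exists s.
have : (2 * r * \sum_(s <- w) exits D s <= size w * (#|` D|.-1))%N.
  rewrite big_distrr /= -sum1_size big_distrl /= big_seq [X in (_ <= X)%N]big_seq.
  by apply: leq_sum => s /wS/lt ltD; rewrite mul1n -ltnS prednK.
have := exits_prod D w; case: (posnP r) => [r0|r0].
  move: sw Dg; rewrite r0 leqn0 => /nilP ->; rewrite !big_nil exits1 !muln0 leqn0.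
  by move=> /eqP D00; move: D0; rewrite D00.
move: Dg sw D0 r0; move: (exits _ _) (\sum_(_ <- _) _)%N (size w) #|` D|.
clear; move=> e f k v ve kr v0 r0 ef F.
have : (r * v <= r * v.-1)%N.
  apply: leq_trans (leq_mul kr (leqnn _)); apply: leq_trans F.
  by rewrite -mulnA mulnCA leq_mul2l (leq_trans ve) ?orbT // leq_mul2l ef orbT.
by rewrite leq_mul2l; lia.
Qed.

End Isoperimetry.

(** * Level sets of Green functions *)

Section Averages.
Context {R : realType} {G : groupType} (mu : {fsfun G -> R with 0}).
Implicit Types (f g : G -> R) (x y z s : G).

Definition avg f : R := \sum_(s <- finsupp mu) mu s * f s.

Lemma eq_avg f g : (forall s, s \in finsupp mu -> f s = g s) -> avg f = avg g.
Proof.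
by move=> fg; rewrite /avg big_seq [RHS]big_seq; apply: eq_bigr => s /fg ->.
Qed.

Lemma avgD f g : avg (fun s => f s + g s) = avg f + avg g.
Proof. by rewrite /avg -big_split; apply: eq_bigr => s _; rewrite mulrDr. Qed.

Lemma avgZ c f : avg (fun s => c * f s) = c * avg f.
Proof. by rewrite /avg big_distrr; apply: eq_bigr => s _; rewrite mulrCA. Qed.

Lemma avg_sum (I : Type) (r : seq I) (p : pred I) (F : I -> G -> R) :
  avg (fun s => \sum_(i <- r | p i) F i s) = \sum_(i <- r | p i) avg (F i).
Proof.
rewrite /avg exchange_big /=; apply: eq_bigr => s _.
by rewrite big_distrr.
Qed.

Hypothesis mu_law : is_law mu.

Lemma avg_cst c : avg (fun=> c) = c.
Proof. by rewrite /avg -big_distrl /= mu_law.2 mul1r. Qed.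

Lemma ler_avg f g : (forall s, s \in finsupp mu -> f s <= g s) ->
  avg f <= avg g.
Proof.
move=> fg; rewrite /avg big_seq [X in _ <= X]big_seq; apply: ler_sum => s sS.
by apply: ler_wpM2l; [exact: mu_law.1 | exact: fg].
Qed.

Lemma avg_ge0 f : (forall s, 0 <= f s) -> 0 <= avg f.
Proof. by move=> f0; rewrite -[0]avg_cst; exact: ler_avg. Qed.

Lemma law_gt0 s : s \in finsupp mu -> 0 < mu s.
Proof. by rewrite mem_finsupp lt_neqAle eq_sym => ->; exact: mu_law.1. Qed.

End Averages.

Section LevelSets.
Context {R : realType} {G : groupType} (mu : {fsfun G -> R with 0}).
Hypotheses (mu_law : is_law mu) (mu_sym : symmetric_law mu).
Implicit Types (D : {fset G}) (f : G -> R).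
Let S := finsupp mu.

Lemma law_symmetric_support : perm_eq S [seq (s^-1)%g | s <- S].
Proof.
apply: uniq_perm; rewrite ?map_inj_uniq ?fset_uniq //; first exact: invg_inj.
move=> s; rewrite -[in RHS](invgK s) mem_map; last exact: invg_inj.
by rewrite !mem_finsupp mu_sym.
Qed.

(* Pairs of neighbours inside [D] contribute nothing to the flux, by antisymmetry. *)
Lemma flux_out D f : \sum_(x <- D) (f x - avg mu (fun s => f (x * s)%g)) =
  \sum_(s <- S) mu s *
     \sum_(x <- D | (x * s)%g \notin D) (f x - f (x * s)%g).
Proof.
pose a s := \sum_(x <- D | (x * s)%g \in D) f x.
have aV s : a (s^-1)%g = \sum_(x <- D | (x * s)%g \in D) f (x * s)%g.
  rewrite /a -big_filter -[RHS]big_filter -(big_map (fun x => x * s)%g xpredT f).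
  apply: perm_big; apply: uniq_perm; rewrite ?map_inj_uniq ?filter_uniq ?fset_uniq //.
    exact: mulIg.
  move=> y; rewrite mem_filter; apply/andP/mapP.
    by move=> [ysD yD]; exists (y * s^-1)%g; rewrite ?mem_filter mulgVK // yD.
  by move=> [x]; rewrite mem_filter => /andP[? ?] ->; rewrite mulgK.
have -> : \sum_(x <- D) (f x - avg mu (fun s => f (x * s)%g)) =
    \sum_(s <- S) mu s * \sum_(x <- D) (f x - f (x * s)%g).
  under [RHS]eq_bigr do rewrite big_distrr.
  rewrite exchange_big /=; apply: eq_bigr => x _.
  rewrite -[in LHS](avg_cst mu_law (f x)) /avg -sumrB.
  by apply: eq_bigr => s _; rewrite mulrBr.
have -> : \sum_(s <- S) mu s * \sum_(x <- D) (f x - f (x * s)%g) =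
    \sum_(s <- S) mu s * (a s - a (s^-1)%g) + \sum_(s <- S) mu s *
     \sum_(x <- D | (x * s)%g \notin D) (f x - f (x * s)%g).
  rewrite -big_split; apply: eq_bigr => s _ /=; rewrite -mulrDr; congr (_ * _).
  by rewrite (bigID (fun x => (x * s)%g \in D)) /= aV sumrB.
rewrite [X in X + _](_ : _ = 0) ?add0r //.
under eq_bigr do rewrite mulrBr.
rewrite sumrB; apply/eqP; rewrite subr_eq0; apply/eqP.
rewrite (perm_big _ law_symmetric_support) big_map.
by apply: eq_bigr => s _; rewrite mu_sym.
Qed.

Lemma flux_le1 D f t : t \in S ->
  (forall x, f x - avg mu (fun s => f (x * s)%g) <= (x == 1%g)%:R) ->
  (forall x y, x \in D -> y \notin D -> f y <= f x) ->
  mu t * \sum_(x <- D | (x * t)%g \notin D) (f x - f (x * t)%g) <= 1.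
Proof.
move=> tS sub lev.
have term_ge0 s : 0 <= mu s * \sum_(x <- D | (x * s)%g \notin D) (f x - f (x * s)%g).
  rewrite mulr_ge0 ?mu_law.1 // big_seq_cond sumr_ge0 // => x /andP[xD xsD].
  by rewrite subr_ge0 lev.
have : \sum_(x <- D) (f x - avg mu (fun s => f (x * s)%g)) <= 1.
  apply: (@le_trans _ _ (\sum_(x <- D) (x == 1%g)%:R)); first exact: ler_sum.
  have -> : \sum_(x <- D) ((x == 1%g)%:R : R) = (count_mem 1%g D)%:R.
    rewrite -sum1_count natr_sum [RHS]big_mkcond; apply: eq_bigr => x _ /=.
    by case: eqP.
  by rewrite (ler_nat R _ 1) count_uniq_mem ?fset_uniq // leq_b1.
rewrite flux_out; apply: le_trans; rewrite [X in _ <= X](big_rem t) //= lerDl.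
by apply: sumr_ge0.
Qed.

Definition level f (W : {fset G}) s : {fset G} := [fset x | x in W & s < f x]%fset.

Lemma in_level f (W : {fset G}) s x : (x \in level f W s) = (x \in W) && (s < f x).
Proof. by rewrite !inE. Qed.

Lemma level_growth D W f t (s del : R) : t \in S ->
  (forall x, f x - avg mu (fun s => f (x * s)%g) <= (x == 1%g)%:R) ->
  D = level f W s ->
  (forall x, 0 < f x -> x \in W) -> 0 <= s -> del <= s ->
  0 < del -> 2 <= del * mu t * (exits D t)%:R ->
  #|` D|%:R + (exits D t)%:R / 2 <= (#|` level f W (s - del)|%:R : R).
Proof.
move=> tS sub DE fW s0 dels del0 large; set D' := level f W (s - del).
have mem_D x : (x \in D) = (s < f x).
  rewrite DE in_level; apply/andP/idP => [[]//|sx]; split=> //.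
  by apply: fW; exact: le_lt_trans sx.
have mem_D' x : (x \in D') = (s - del < f x).
  rewrite in_level; apply/andP/idP => [[]//|sx]; split=> //.
  by apply: fW; apply: le_lt_trans sx; rewrite subr_ge0.
pose far x := del <= f x - f (x * t)%g.
pose out x := (x * t)%g \notin D.
have lev x y : x \in D -> y \notin D -> f y <= f x.
  by rewrite !mem_D -leNgt => sx /le_trans; apply; exact: ltW.
have few : 2 * (count (predI out far) D)%:R <= ((exits D t)%:R : R).
  have := flux_le1 tS sub lev.
  have : del * (count (predI out far) D)%:R <=
      \sum_(x <- D | (x * t)%g \notin D) (f x - f (x * t)%g).
    rewrite (bigID far) /= -[X in X <= _]addr0; apply: lerD.
      rewrite -sum1_count natr_sum mulr_sumr; apply: ler_sum => x /andP[_].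
      by rewrite mulr1.
    rewrite big_seq_cond; apply: sumr_ge0 => x /andP[xD /andP[xtD _]].
    by rewrite subr_ge0 lev.
  have mt := law_gt0 mu_law tS.
  move: large mt del0; set b := (exits D t)%:R; set n := (count _ _)%:R.
  set F := \sum_(_ <- _ | _) _; move: (mu t) => m large m0 d0 le1 le2.
  have dm0 : 0 < del * m by rewrite mulr_gt0.
  rewrite -(ler_pM2l dm0); apply: le_trans large.
  have : m * (del * n) <= m * F by rewrite ler_pM2l.
  clear -le2; nra.
have split_out : (exits D t = count (predI out far) D + count (predI out (predC far)) D)%N.
  rewrite /exits -size_filter -(count_predC far) !count_filter.
  by congr addn; apply: eq_count => x /=; rewrite andbC.
rewrite split_out natrD in few *.
have : (#|` D| + count (predI out (predC far)) D <= #|` D'|)%N.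
  rewrite -size_filter -(size_map (fun x => x * t)%g) -size_cat.
  apply: uniq_leq_size.
    rewrite cat_uniq fset_uniq map_inj_uniq ?filter_uniq ?fset_uniq //; last exact: mulIg.
    rewrite andbT; apply/hasPn => y /mapP[x]; rewrite mem_filter => /andP[/andP[xo _] _] ->.
    exact: xo.
  move=> y; rewrite mem_cat mem_D mem_D' => /orP[sy|/mapP[x]].
    by apply: lt_trans sy; rewrite gtrBl.
  rewrite mem_filter mem_D => /andP[/andP[_ /=]]; rewrite /far -ltNge => xf sx ->.
  by move: xf sx; lra.
by rewrite -(ler_nat R) natrD; move: few; lra.
Qed.

(* The potential [(4 + ln v)^2 / v] drops by the height needed for [v] to grow. *)
Lemma potential_drop (a m M v v' : R) : 1 <= a -> 0 < m -> 64 * a ^+ 2 / m <= M ->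
  1 <= v -> v * (1 + (4 * a * (4 + ln v))^-1) <= v' ->
  M * (4 + ln v') ^+ 2 / v' + 4 * a * (4 + ln v) / (m * v) <=
  M * (4 + ln v) ^+ 2 / v.
Proof.
move=> a1 m0 aM v1; set l := 4 + ln v; set e := (_)^-1 => vv'.
have l4 : 4 <= l by rewrite lerDl ln_ge0.
have v0 : 0 < v by apply: lt_le_trans v1.
have a0 : 0 < a by lra.
have l0 : 0 < l by lra.
have al4 : 4 <= 4 * a * l by nra.
have e0 : 0 < e by rewrite invr_gt0; apply: lt_le_trans al4.
have e1 : e <= 1.
  by rewrite invf_le1; [apply: le_trans al4; lra|apply: lt_le_trans al4].
have M0 : 0 < M by apply: lt_le_trans aM; rewrite divr_gt0 // mulr_gt0 ?exprn_gt0 //; lra.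
pose y := v' / v.
have y1 : 1 + e <= y by rewrite ler_pdivlMr // mulrC.
have v'E : v' = v * y by rewrite /y mulrCA divff ?mulr1 // gt_eqF.
have y0 : 0 < y by apply: lt_le_trans y1; lra.
pose q := expR (- (ln y / 2)).
have q2y : q ^+ 2 * y = 1.
  rewrite /q -[y in _ * y]lnK ?posrE // expr2 -!expRD -[RHS]expR0; congr expR; by field.
have q0 : 0 < q by exact: expR_gt0.
have qe : q <= 1 - e / 4.
  rewrite leNgt; apply/negP => lt.
  have : (1 - e / 4) ^+ 2 * (1 + e) < q ^+ 2 * y.
    apply: (@lt_le_trans _ _ (q ^+ 2 * (1 + e))).
      by rewrite ltr_pM2r ?ltr_pXn2r ?nnegrE //; lra.
    by rewrite ler_pM2l ?exprn_gt0.
  rewrite q2y; clear -e0 e1; nra.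
have l' : 4 + ln v' = l + ln y by rewrite v'E lnM ?posrE // addrA.
have ly0 : 0 <= ln y by rewrite ln_ge0 //; lra.
have sq : (4 + ln v') ^+ 2 <= l ^+ 2 * (q * y).
  have -> : q * y = expR (ln y / 4) ^+ 2.
    rewrite /q -[y in _ * y]lnK ?posrE // expr2 -!expRD; congr expR; by field.
  rewrite -exprMn ler_pXn2r ?nnegrE //; [|lra|by rewrite mulr_ge0 ?expR_ge0 //; lra].
  rewrite l'; apply: (@le_trans _ _ (l * (1 + ln y / 4))); first by nra.
  by rewrite ler_pM2l ?expR_ge1Dx //; lra.
have step1 : M * (4 + ln v') ^+ 2 / v' <= M * l ^+ 2 / v * (1 - e / 4).
  apply: (@le_trans _ _ (M * (l ^+ 2 * (q * y)) / v')).
    have v'0 : 0 < v' by rewrite v'E mulr_gt0.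
    by rewrite ler_pM2r ?invr_gt0 // ler_pM2l.
  have -> : M * (l ^+ 2 * (q * y)) / v' = M * l ^+ 2 / v * q.
    by rewrite v'E; field; rewrite ?gt_eqF.
  by rewrite ler_pM2l // divr_gt0 // mulr_gt0 ?exprn_gt0 //; lra.
suff step2 : 4 * a * l / (m * v) <= M * l ^+ 2 / v * (e / 4).
  by move: step1 step2; rewrite mulrBr mulr1; lra.
have -> : M * l ^+ 2 / v * (e / 4) = M * l / (16 * a * v).
  by rewrite /e; field; rewrite ?gt_eqF.
rewrite ler_pdivrMr ?mulr_gt0 //.
have -> : M * l / (16 * a * v) * (m * v) = (M * m) * l / (16 * a).
  by field; rewrite ?gt_eqF.
rewrite ler_pdivlMr; last by lra.
move: aM; rewrite ler_pdivrMr // => aM.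
have : 64 * a ^+ 2 * l <= M * m * l by rewrite ler_pM2r //; lra.
by lra.
Qed.

Hypothesis (S_gen : generates S) (G_exp : exponential_growth R S).

Lemma level_volume : exists2 M : R, 0 < M & forall f (W : {fset G}),
  (forall x, 0 < f x -> x \in W) ->
  (forall x, f x - avg mu (fun s => f (x * s)%g) <= (x == 1%g)%:R) ->
  forall s, 0 <= s -> (0 < #|` level f W s|)%N ->
  s * #|` level f W s|%:R <=
    M * (4 + ln (#|` level f W s|%:R)) ^+ 2.
Proof.
case: G_exp => c [c0 growth].
have [m m0 mle] : exists2 m, 0 < m & forall t, t \in S -> m <= mu t.
  suff : forall r : seq G, {subset r <= S} ->
      exists2 m, 0 < m & forall t, t \in r -> m <= mu t by apply.
  elim=> [|s r IHr] rS; first by exists 1.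
  have [|m m0 mle] := IHr; first by move=> x xr; rewrite rS // inE xr orbT.
  exists (Num.min m (mu s)).
    by rewrite lt_min m0 (law_gt0 mu_law) // rS // mem_head.
  move=> t; rewrite inE ge_min => /orP[/eqP ->|/mle ->]; first by rewrite lexx orbT.
  by [].
pose a := c^-1 + 1.
have a1 : 1 <= a by rewrite lerDr invr_ge0 ltW.
exists (64 * a ^+ 2 / m) => [|f W fW sub].
  by rewrite divr_gt0 // mulr_gt0 ?exprn_gt0 //; lra.
set M := 64 * a ^+ 2 / m.
pose D := level f W.
move=> s; have [k] := ubnP (#|` W| - #|` D s|)%N.
elim: k s => // k IHk s; rewrite ltnS => kW s0 D0; rewrite -/(D s) in D0 *.
set v := #|` D s|%:R : R.
have v1 : 1 <= v by rewrite ler1n.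
have v0 : 0 < v by apply: lt_le_trans v1.
set l := 4 + ln v.
have l4 : 4 <= l by rewrite lerDl ln_ge0.
pose r := (Num.truncn (ln (2 * v) / c)).+1.
have r_ge : ln (2 * v) / c < r%:R by exact: truncnS_gt.
have r_le : r%:R <= a * l.
  have : ln (2 * v) <= 1 + ln v.
    by rewrite lnM ?posrE // lerD2r; have := @le_ln1Dx R 1; rewrite -[1+1]/2; apply; lra.
  have lv : 0 <= ln v by exact: ln_ge0.
  have l2v : 0 <= ln (2 * v) by apply: ln_ge0; lra.
  move=> up; have : r%:R <= ln (2 * v) / c + 1.
    by rewrite /r -natr1 lerD2r truncn_le // divr_ge0 // ltW.
  move/le_trans; apply; rewrite /a (mulrDl c^-1) mul1r; apply: lerD; last by rewrite /l; lra.
  by rewrite mulrC ler_pM2l ?invr_gt0 // /l; lra.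
have r0 : 0 < r%:R :> R by rewrite ltr0n.
have [t tS vt] : exists2 t, t \in S & (#|` D s| <= 2 * r * exits (D s) t)%N.
  apply: (isoperimetry S_gen growth) => //.
  rewrite natrM -/v -[X in X <= _]lnK ?posrE ?mulr_gt0 // ler_expR.
  by move: r_ge; rewrite ltr_pdivrMr // (mulrC _ c) => /ltW.
set b := (exits (D s) t)%:R : R.
have vb : v <= 2 * r%:R * b by rewrite /v /b -!natrM ler_nat.
have b0 : 0 < b.
  rewrite ltr0n lt0n; apply/negP => /eqP b0; move: vt; rewrite b0 muln0 leqn0.
  by move: D0; rewrite lt0n => /negPf ->.
pose del := 2 / (m * b).
have del0 : 0 < del by rewrite divr_gt0 // mulr_gt0.
have del_le : del <= 4 * a * l / (m * v).
  rewrite ler_pdivrMr ?mulr_gt0 // mulrAC ler_pdivlMr ?mulr_gt0 //.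
  have : v <= 2 * (a * l) * b.
    by apply: le_trans vb _; rewrite ler_pM2r // ler_pM2l.
  move=> vab; clear -m0 vab; nra.
case: (lerP del s) => [dels|/ltW sdel]; last first.
  apply: (@le_trans _ _ (4 * a * l / (m * v) * v)).
    by rewrite ler_pM2r //; exact: le_trans del_le.
  have -> : 4 * a * l / (m * v) * v = 4 * a * l / m by field; rewrite ?gt_eqF.
  rewrite /M [X in _ <= X]mulrAC ler_pM2r ?invr_gt0 //.
  have al1 : 1 <= a * l by nra.
  have -> : 64 * a ^+ 2 * l ^+ 2 = 64 * (a * l * (a * l)) by ring.
  by clear -al1; nra.
have grow : v + b / 2 <= #|` D (s - del)|%:R.
  apply: level_growth => //.
  have := mle _ tS; rewrite /del => mt.
  have -> : 2 / (m * b) * mu t * b = 2 * (mu t / m) by field; rewrite ?gt_eqF.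
  by rewrite ler_pMr // ler_pdivlMr // mul1r.
have sub_W e : (#|` D e| <= #|` W|)%N.
  by apply: fsubset_leq_card; apply/fsubsetP => x; rewrite in_level => /andP[].
have lt_card : (#|` D s| < #|` D (s - del)%R|)%N.
  by rewrite -(ltr_nat R); apply: lt_le_trans grow; rewrite ltrDl divr_gt0.
have /IHk : (#|` W| - #|` D (s - del)%R| < k)%N.
  by apply: leq_trans kW; rewrite ltn_sub2l //; exact: leq_trans (sub_W (s - del)).
rewrite subr_ge0 dels => /(_ isT); rewrite (leq_ltn_trans _ lt_card) // => /(_ isT).
rewrite -/(D _); set v' := #|` D (s - del)|%:R : R.
have v'0 : 0 < v' by apply: lt_trans v0 _; rewrite ltr_nat.
rewrite -ler_pdivlMr // => IH.
have drop := @potential_drop a m M v v' a1 m0 (lexx _) v1.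
rewrite -ler_pdivlMr //; apply: le_trans (drop _).
  by rewrite -/l -[s](subrK del) lerD.
rewrite -/l; apply: le_trans grow; rewrite mulrDr mulr1 lerD2l.
rewrite ler_pdivrMr; last by rewrite mulr_gt0 //; lra.
apply: le_trans vb _.
have : 2 * r%:R * b <= 2 * (a * l) * b by rewrite ler_pM2r // ler_pM2l.
by lra.
Qed.

End LevelSets.

(** * Truncated Green functions and hitting probabilities *)

Section TruncatedKernels.
Context {R : realType} {G : groupType} (mu : {fsfun G -> R with 0}).
Hypothesis mu_law : is_law mu.
Implicit Types (x y z s : G) (A : seq G) (T : nat).
Let S := finsupp mu.

(* [green T] counts visits at times [< T], while [hit T] looks at times [<= T]. *)
Fixpoint green T x y : R :=
  if T is n.+1 then (x == y)%:R + avg mu (fun s => green n (x * s)%g y) else 0.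

Fixpoint hit T x y : R :=
  if x == y then 1
  else if T is n.+1 then avg mu (fun s => hit n (x * s)%g y) else 0.

Fixpoint stay T A x : R :=
  if x \in A then
    if T is n.+1 then avg mu (fun s => stay n A (x * s)%g) else 1
  else 0.

Lemma green_ge0 T x y : 0 <= green T x y.
Proof. by elim: T x => //= T IHT x; rewrite addr_ge0 ?avg_ge0. Qed.

Lemma green_mono T x y : green T x y <= green T.+1 x y.
Proof.
elim: T x => [|T IHT] x; first exact: green_ge0.
by rewrite /= lerD2l; apply: ler_avg => // s _; exact: IHT.
Qed.

Lemma green_support T : exists W : {fset G}, forall x, 0 < green T x 1%g -> x \in W.
Proof.
elim: T => [|T [W HW]]; first by exists fset0 => x /=; rewrite ltxx.
exists (1%g |` [fset (w * s^-1)%g | w in W, s in S])%fset => x /= pos.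
apply: contraT; rewrite !inE negb_or => /andP[/negPf x1 xW].
move: pos; rewrite x1 add0r ltNge => /negP[].
rewrite -[leRHS](avg_cst mu_law); apply: ler_avg => // s sS; rewrite leNgt.
apply: contra xW => /HW xs; apply/imfset2P; exists (x * s)%g => //.
by exists s => //; rewrite mulgK.
Qed.

Lemma green_mul T a x y : green T (a * x)%g (a * y)%g = green T x y.
Proof.
elim: T x => //= T IHT x; rewrite (can_eq (mulKg a)); congr (_ + _).
by apply: eq_avg => s _; rewrite -mulgA IHT.
Qed.

Lemma hit_mul T a x y : hit T (a * x)%g (a * y)%g = hit T x y.
Proof.
elim: T x => /= [|T IHT] x; rewrite (can_eq (mulKg a)) //; case: eqP => // _.
by apply: eq_avg => s _; rewrite -mulgA IHT.
Qed.

Lemma hitxx T x : hit T x x = 1.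
Proof. by case: T => [|T] /=; rewrite eqxx. Qed.

Lemma hit_ge0 T x y : 0 <= hit T x y.
Proof. by elim: T x => /= [|T IHT] x; case: eqP => // _; rewrite avg_ge0. Qed.

Lemma hit_le1 T x y : hit T x y <= 1.
Proof.
elim: T x => /= [|T IHT] x; case: eqP => // _.
by rewrite -[leRHS](avg_cst mu_law); apply: ler_avg => // s _; exact: IHT.
Qed.

Lemma hit_mono T T' x y : (T <= T')%N -> hit T x y <= hit T' x y.
Proof.
elim: T T' x => [|T IHT] [|T'] x //= TT'; case: eqP => // _.
  by rewrite avg_ge0 // => s; exact: hit_ge0.
by apply: ler_avg => // s _; exact: IHT.
Qed.

Lemma hit_le_green T x y : hit T x y <= green T.+1 x y.
Proof.
elim: T x => [|T IHT] x; rewrite [hit _ _ _]/= [green _ _ _]/=; case: eqP => _.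
- by rewrite lerDl avg_ge0.
- by rewrite add0r avg_ge0.
- by rewrite lerDl avg_ge0 // => s; exact: (green_ge0 T.+1).
- by rewrite add0r; apply: ler_avg => // s _; exact: IHT.
Qed.

Lemma hit_trans j k x y z : hit j x y * hit k y z <= hit (j + k) x z.
Proof.
elim: j x => [|j IHj] x /=; case: (eqVneq x y) => [->|xy].
- by rewrite mul1r.
- by rewrite mul0r hit_ge0.
- by rewrite mul1r (hit_mono _ _ (leq_addl j.+1 k)).
case: (eqVneq x z) => [_|xz].
  have := hit_ge0 j.+1 x y; have := hit_le1 j.+1 x y; rewrite /= (negPf xy) => le1 ge0.
  by rewrite mulr_ile1 ?hit_ge0 ?hit_le1.
rewrite mulrC -avgZ; apply: ler_avg => // s _.
by rewrite mulrC; exact: IHj.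
Qed.

Lemma hit_step x s : s \in S -> mu s <= hit 1 x (x * s)%g.
Proof.
move=> sS /=; case: eqP => _.
  rewrite -mu_law.2 (big_rem s) //= lerDl sumr_ge0 // => t _; exact: mu_law.1.
rewrite /avg (big_rem s) //= eqxx mulr1 lerDl.
by apply: sumr_ge0 => t _; rewrite mulr_ge0 ?mu_law.1 //; case: ifP.
Qed.

Lemma stay_le1 T A x : stay T A x <= 1.
Proof.
elim: T x => /= [|T IHT] x; case: ifP => // _.
by rewrite -[leRHS](avg_cst mu_law); apply: ler_avg => // s _; exact: IHT.
Qed.

Lemma stay_antimono T A x : stay T.+1 A x <= stay T A x.
Proof.
elim: T x => [|T IHT] x.
  rewrite [stay 1 A x]/= [stay 0 A x]/=; case: ifP => // _.
  by rewrite -[leRHS](avg_cst mu_law); apply: ler_avg => // s _; exact: (stay_le1 0).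
rewrite [stay T.+2 _ _]/= [stay T.+1 A x]/=; case: ifP => // _.
by apply: ler_avg => // s _; exact: IHT.
Qed.

Lemma stay_green T A x :
  T%:R * stay T A x <= \sum_(y <- A) green T x y.
Proof.
have anti m n : (m <= n)%N -> stay n A x <= stay m A x.
  elim: n => [|n IHn]; first by rewrite leqn0 => /eqP ->.
  rewrite leq_eqVlt => /orP[/eqP -> //|/IHn]; apply: le_trans.
  exact: stay_antimono.
apply: (@le_trans _ _ (\sum_(t < T) stay t A x)).
  rewrite -[X in X%:R]card_ord mulr_natl -sumr_const.
  by apply: ler_sum => t _; rewrite anti // ltnW.
elim: T x {anti} => [|T IHT] x; first by rewrite big_ord0 sumr_ge0.
have [xA|xA] := boolP (x \in A); last first.
  rewrite big1 => [|t _]; last by case: (t : nat) => /= [|?]; rewrite (negPf xA).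
  by apply: sumr_ge0 => y _; exact: green_ge0.
rewrite big_ord_recl /= xA.
under [X in _ <= X]eq_bigr do rewrite /=.
rewrite big_split /=; apply: lerD.
  rewrite (big_rem x) //= eqxx lerDl; exact: sumr_ge0.
rewrite -avg_sum -avg_sum; apply: ler_avg => // s _; exact: IHT.
Qed.

Lemma exit_le_hit T A (E : seq G) x :
  (forall y s, y \in A -> s \in S -> (y * s)%g \notin A -> (y * s)%g \in E) ->
  x \in A \/ x \in E ->
  1 - stay T A x <= \sum_(y <- E | y \notin A) hit T x y.
Proof.
move=> AE; have sum_ge0 n z : 0 <= \sum_(y <- E | y \notin A) hit n z y.
  by apply: sumr_ge0 => y _; exact: hit_ge0.
have outA n z : z \notin A -> z \in E ->
    1 <= \sum_(y <- E | y \notin A) hit n z y.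
  move=> zA zE; rewrite (big_rem z) //= zA hitxx lerDl sumr_ge0 // => y _.
  exact: hit_ge0.
elim: T x => [|T IHT] x xAE /=; case: ifP => [xA|/negbT xA].
- by rewrite subrr; exact: (sum_ge0 0).
- by rewrite subr0; apply: (outA 0) => //; case: xAE => // xA'; rewrite xA' in xA.
- apply: (@le_trans _ _ (avg mu (fun s => \sum_(y <- E | y \notin A) hit T (x * s)%g y))).
    rewrite -[X in X - _](avg_cst mu_law) -[X in _ - X]mul1r -mulNr -avgZ -avgD.
    apply: ler_avg => // s sS; rewrite mulN1r; apply: IHT.
    have [|xsA] := boolP ((x * s)%g \in A); first by left.
    by right; exact: AE xsA.
  rewrite avg_sum; apply: ler_sum => y yA.
  by case: eqP => // xy; rewrite -xy xA in yA.
- by rewrite subr0; apply: (outA T.+1) => //; case: xAE => // xA'; rewrite xA' in xA.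
Qed.

Hypotheses (mu_sym : symmetric_law mu) (S_gen : generates S)
  (G_exp : exponential_growth R S).

Lemma green_level : exists2 M : R, 0 < M & forall T r (E : {fset G}),
  0 <= r -> (forall x, x \in E -> r < green T x 1%g) -> (0 < #|` E|)%N ->
  exists v : R, [/\ #|` E|%:R <= v, 1 <= v & r * v <= M * (4 + ln v) ^+ 2].
Proof.
have [M M0 HM] := level_volume mu_law mu_sym S_gen G_exp; exists M => // T r E r0 HE E0.
have [W HW] := green_support T.
have sub : (#|` E| <= #|` level (green T ^~ 1%g) W r|)%N.
  apply: fsubset_leq_card; apply/fsubsetP => x xE; rewrite in_level HE // HW //.
  exact: le_lt_trans r0 (HE _ xE).
have lev0 := leq_trans E0 sub.
exists #|` level (green T ^~ 1%g) W r|%:R; split.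
- by rewrite ler_nat.
- by rewrite ler1n.
apply: HM => // x; rewrite lerBlDr.
exact: (green_mono T x 1%g).
Qed.

(* [1 + t <= expR t] with [t = ln v / 4]. *)
Lemma sqr_4ln_le (v : R) : 1 <= v -> (4 + ln v) ^+ 2 <= 16 * expR (ln v / 2).
Proof.
move=> v1; have lv : 0 <= ln v by exact: ln_ge0.
have -> : 16 * expR (ln v / 2) = (4 * expR (ln v / 4)) ^+ 2.
  by rewrite exprMn [_ ^+ 2 in RHS]expr2 [expR _ ^+ 2]expr2 -expRD; congr (_ * expR _); [ring|field].
rewrite ler_pXn2r ?nnegrE ?mulr_ge0 ?expR_ge0 ?addr_ge0 //.
by have := expR_ge1Dx (ln v / 4); lra.
Qed.

Lemma green_bounded : exists2 C : R, 0 < C & forall T x y, green T x y <= C.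
Proof.
have [M M0 HM] := green_level; exists (17 * M) => [|T x y]; first by rewrite mulr_gt0.
rewrite -(green_mul T (y^-1)%g) mulVg; set z := (_ * x)%g.
rewrite leNgt; apply/negP => lt.
have [|||v [_ v1]] := HM T (17 * M) [fset z]%fset; rewrite ?cardfs1 //.
- by rewrite mulr_ge0 // ltW.
- by move=> w /fset1P ->.
apply/negP; rewrite -ltNge.
apply: (@le_lt_trans _ _ (M * (16 * v))); last first.
  by rewrite mulrCA mulrA ltr_pM2r ?ltr_pM2r //; [lra|apply: lt_le_trans v1].
rewrite ler_pM2l //; apply: le_trans (sqr_4ln_le v1) _; rewrite ler_pM2l //.
rewrite -[leRHS]lnK ?posrE; last by apply: lt_le_trans v1.
by rewrite ler_expR; have := ln_ge0 v1; lra.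
Qed.

Lemma hit_volume : exists2 C : R, 0 < C & forall T a (E : {fset G}), 0 <= a ->
  (forall x, x \in E -> expR (- a) < hit T 1%g x) ->
  #|` E|%:R <= C * (1 + a) ^+ 2 * expR a.
Proof.
have [M M0 HM] := green_level.
pose q := 16 * M + 1; have q1 : 1 <= q by rewrite /q; lra.
have lq : 0 <= ln q by exact: ln_ge0.
exists (M * (4 + 2 * ln q) ^+ 2) => [|T a E a0 HE].
  by rewrite mulr_gt0 // exprn_gt0 //; lra.
have [/cardfs0_eq ->|E0] := posnP #|` E|.
  rewrite cardfs0 mulr_ge0 ?expR_ge0 // mulr_ge0 ?exprn_ge0 ?mulr_ge0 ?exprn_ge0 //; lra.
pose E' := [fset (x^-1)%g | x in E]%fset.
have cE' : #|` E'| = #|` E| by rewrite card_imfset //; exact: invg_inj.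
have [|||v [Ev v1 HMv]] := HM T.+1 (expR (- a)) E'; rewrite ?expR_ge0 ?cE' //.
  move=> y /imfsetP[x xE ->]; apply: lt_le_trans (HE x xE) _.
  by rewrite -(hit_mul T (x^-1)%g) mulg1 mulVg; exact: hit_le_green.
have v0 : 0 < v by apply: lt_le_trans v1.
have vle : v <= expR a * (M * (4 + ln v) ^+ 2).
  have -> : v = expR a * (expR (- a) * v) by rewrite mulrA -expRD addrN expR0 mul1r.
  by rewrite ler_pM2l ?expR_gt0 // mulrA -expRD addrN expR0 mul1r.
have lnv : ln v <= 2 * (ln q + a).
  have : expR (ln v) <= expR (a + ln q + ln v / 2).
    rewrite lnK ?posrE // !expRD lnK ?posrE; last by lra.
    apply: le_trans vle _; rewrite -mulrA ler_pM2l ?expR_gt0 //.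
    apply: (@le_trans _ _ (M * (16 * expR (ln v / 2)))).
      by rewrite ler_pM2l // sqr_4ln_le.
    by rewrite mulrA ler_pM2r ?expR_gt0 // /q; lra.
  by rewrite ler_expR; lra.
have lv : 0 <= ln v by exact: ln_ge0.
rewrite -cE'; apply: le_trans Ev _; apply: le_trans vle _; rewrite mulrC ler_pM2r ?expR_gt0 //.
rewrite -mulrA ler_pM2l // -exprMn ler_pXn2r ?nnegrE //; [|lra|by rewrite mulr_ge0 //; lra].
by nra.
Qed.

End TruncatedKernels.

(** * Clusters built from finite words *)

Section Words.
Context {R : realType} {G : groupType} (mu : {fsfun G -> R with 0}).
Hypothesis mu_law : is_law mu.
Implicit Types (x y z s : G) (A u v : seq G) (T M m n : nat) (f g : seq G -> R).
Let S := finsupp mu.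

(* Expectation of [f] at a word of [n] independent letters of law [mu]. *)
Fixpoint expword n f : R :=
  if n is m.+1 then avg mu (fun s => expword m (fun u => f (s :: u))) else f [::].

Lemma eq_expword n f g : (forall u, size u = n -> f u = g u) ->
  expword n f = expword n g.
Proof.
elim: n f g => /= [|n IHn] f g fg; first exact: fg.
by apply: eq_avg => s _; apply: IHn => u un; rewrite fg //= un.
Qed.

Lemma ler_expword n f g : (forall u, size u = n -> f u <= g u) ->
  expword n f <= expword n g.
Proof.
elim: n f g => /= [|n IHn] f g fg; first exact: fg.
by apply: ler_avg => // s _; apply: IHn => u un; rewrite fg //= un.
Qed.

Lemma expword_cst n (c : R) : expword n (fun=> c) = c.
Proof.
elim: n => //= n IHn; rewrite -[RHS](avg_cst mu_law).
by apply: eq_avg => s _.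
Qed.

Lemma expwordD n f g : expword n (fun u => f u + g u) = expword n f + expword n g.
Proof.
elim: n f g => //= n IHn f g; rewrite -avgD.
by apply: eq_avg => s _; rewrite IHn.
Qed.

Lemma expwordZ n (c : R) f : expword n (fun u => c * f u) = c * expword n f.
Proof.
elim: n f => //= n IHn f; rewrite -avgZ.
by apply: eq_avg => s _; rewrite IHn.
Qed.

Lemma expword_sum n (I : Type) (r : seq I) (F : I -> seq G -> R) :
  expword n (fun u => \sum_(i <- r) F i u) = \sum_(i <- r) expword n (F i).
Proof.
elim: r => [|i r IHr].
  by rewrite big_nil -[RHS](expword_cst n 0); apply: eq_expword => u _; rewrite big_nil.
rewrite big_cons -IHr -expwordD; apply: eq_expword => u _.
by rewrite big_cons.
Qed.

Lemma expword_cat m n f :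
  expword (m + n) f = expword m (fun u => expword n (fun v => f (u ++ v))).
Proof. by elim: m f => //= m IHm f; apply: eq_avg => s _; rewrite IHm. Qed.

Fixpoint settle A x u : option G :=
  if x \in A then if u is s :: v then settle A (x * s)%g v else None
  else Some x.

Lemma settle_notin A x u y : settle A x u = Some y -> y \notin A.
Proof.
elim: u x => /= [|s u IHu] x; case: ifP => //= xA; last first.
- by move=> [<-]; rewrite xA.
- exact: IHu.
- by move=> [<-]; rewrite xA.
Qed.

Lemma settle_subharmonic T A z (f : G -> R) x : z \notin A ->
  (forall y, f y <= 1) ->
  (forall y, y != z -> f y <= avg mu (fun s => f (y * s)%g)) ->
  f x <= expword T (fun u => oapp f 0 (settle A x u)) + stay mu T A x.
Proof.
move=> zA f1 sub; elim: T x => /= [|T IHT] x; case: ifP => xA.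
- by rewrite add0r.
- by rewrite addr0.
- apply: (@le_trans _ _ (avg mu (fun s => f (x * s)%g))).
    by apply: sub; apply: contraNneq zA => <-.
  by rewrite -avgD; apply: ler_avg => // s _; exact: IHT.
- have -> : avg mu (fun=> expword T (fun=> f x)) = f x by exact: (expword_cst T.+1).
  by rewrite addr0.
Qed.

Lemma settle_exp_le T A z (f : G -> R) x : z \notin A ->
  (forall y, 0 <= f y <= 1) ->
  (forall y, y != z -> f y <= avg mu (fun s => f (y * s)%g)) ->
  expword T (fun u => expR (- oapp f 0 (settle A x u))) <=
    1 - (f x - stay mu T A x) / 2.
Proof.
move=> zA f01 sub.
have := @settle_subharmonic T A z f x zA (fun y => proj2 (andP (f01 y))) sub.
rewrite -lerBlDr => le.
apply: (@le_trans _ _ (expword T (fun u => 1 + (- 2^-1) * oapp f 0 (settle A x u)))).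
  apply: ler_expword => u _; set t := oapp _ _ _.
  have /andP[t0 t1] : 0 <= t <= 1 by rewrite /t; case: settle => //=; rewrite lexx ler01.
  rewrite expRN -[leLHS]mul1r ler_pdivrMr ?expR_gt0 //.
  by have := expR_ge1Dx t; clear -t0 t1; nra.
by rewrite expwordD expword_cst expwordZ; lra.
Qed.

Lemma settle_far T A x (b0 b1 : pred G) : (x \in A) || b1 x ->
  (forall y s, b0 y -> s \in S -> b1 (y * s)%g) ->
  expword T (fun u => (oapp (predC b1) false (settle A x u))%:R) <=
    \sum_(y <- A | ~~ b0 y) hit mu T x y.
Proof.
move=> + b01; have sum_ge0 n z : 0 <= \sum_(y <- A | ~~ b0 y) hit mu n z y.
  by apply: sumr_ge0 => y _; exact: hit_ge0.
elim: T x => [|T IHT] x; have [xA|xA] := boolP (x \in A);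
  rewrite /= ?xA ?(negPf xA) /= => xb.
- exact: (sum_ge0 0).
- by rewrite xb; exact: (sum_ge0 0).
- have [bx|bx] := boolP (b0 x).
    apply: (@le_trans _ _ (avg mu (fun s => \sum_(y <- A | ~~ b0 y) hit mu T (x * s)%g y))).
      by apply: ler_avg => // s sS; apply: IHT; rewrite b01 ?orbT.
    rewrite avg_sum; apply: ler_sum => y yb.
    by case: eqP => // xy; rewrite -xy bx in yb.
  apply: (@le_trans _ _ 1).
    rewrite -[leRHS](avg_cst mu_law); apply: ler_avg => // s _.
    rewrite -[leRHS](expword_cst T); apply: ler_expword => u _.
    by rewrite lern1 leq_b1.
  rewrite (big_rem x) //= bx eqxx lerDl; apply: sumr_ge0 => y _.
  exact: (hit_ge0 mu_law T.+1).
- rewrite xb (_ : avg _ _ = 0); first exact: (sum_ge0 T.+1).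
  exact: (expword_cst T.+1 0).
Qed.

Definition grow A u := if settle A 1%g u is Some y then y :: A else A.

(* [cluster T M] stands for A(M + 1): the identity is not counted in [M], and a
   particle that has not settled after [T] steps is discarded. *)
Fixpoint cluster T M u : seq G :=
  if M is m.+1 then grow (cluster T m (take (m * T) u)) (drop (m * T) u)
  else [:: 1%g].

Lemma expword_cluster T m (F : seq G -> R) :
  expword (m.+1 * T) (fun u => F (cluster T m.+1 u)) =
  expword (m * T) (fun u => expword T (fun v => F (grow (cluster T m u) v))).
Proof.
rewrite mulSn addnC expword_cat; apply: eq_expword => u un.
by apply: eq_expword => v _ /=; rewrite -un take_size_cat // drop_size_cat.
Qed.

Lemma cluster_uniq T M u : uniq (cluster T M u).
Proof.
elim: M u => //= m IHm u; rewrite /grow; case E: settle => [y|] //=.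
by rewrite IHm (settle_notin E).
Qed.

Lemma size_cluster T M u : (size (cluster T M u) <= M.+1)%N.
Proof.
elim: M u => //= m IHm u; rewrite /grow; case: settle => [y|] /=; first exact: IHm.
exact: leq_trans (IHm _) _.
Qed.

Lemma cluster_miss T M z (f : G -> R) (eps U : R) :
  (forall y, 0 <= f y <= 1) ->
  (forall y, y != z -> f y <= avg mu (fun s => f (y * s)%g)) ->
  0 <= eps -> (forall A, (size A <= M)%N -> stay mu T A 1%g <= eps) ->
  (forall A, uniq A -> \sum_(y <- A) f y <= U) ->
  expword (M * T) (fun u => (z \notin cluster T M u)%:R) <=
    expR (U - M%:R * ((f 1%g - eps) / 2)).
Proof.
move=> f01 sub eps0 stayM fU.
pose phi A := (z \notin A)%:R * expR (- \sum_(y <- A) f y).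
have phi_ge0 A : 0 <= phi A by rewrite mulr_ge0 ?expR_ge0.
set q := (f 1%g - eps) / 2.
have q1 : 0 <= 1 - q.
  by have /andP[] := f01 1%g; rewrite /q; lra.
have main m : (m <= M)%N -> expword (m * T) (fun u => phi (cluster T m u)) <= (1 - q) ^+ m.
  elim: m => [_|m IHm mM].
    rewrite /= /phi big_seq1 expr0; apply: mulr_ile1; rewrite ?expR_ge0 ?lern1 ?leq_b1 //.
    by rewrite -[leRHS]expR0 ler_expR oppr_le0; case/andP: (f01 1%g).
  rewrite expword_cluster exprS.
  apply: le_trans (ler_wpM2l q1 (IHm (ltnW mM))); rewrite -expwordZ.
  apply: ler_expword => u _; set A := cluster T m u.
  have [zA|zA] := boolP (z \in A).
    rewrite (_ : phi A = 0) ?mulr0; last by rewrite /phi zA mul0r.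
    rewrite (eq_expword (g := fun=> 0)) ?expword_cst // => v _.
    by rewrite /phi /grow; case: settle => [y|]; rewrite ?inE zA ?orbT mul0r.
  apply: (@le_trans _ _ (expword T (fun v => phi A * expR (- oapp f 0 (settle A 1%g v))))).
    apply: ler_expword => v _; rewrite /phi /grow zA mul1r.
    case: settle => [y|] /=; last by rewrite zA mul1r oppr0 expR0 mulr1.
    rewrite big_cons opprD expRD [expR (- f y) * _]mulrC.
    by rewrite ler_piMl ?mulr_ge0 ?expR_ge0 // lern1 leq_b1.
  rewrite expwordZ mulrC; apply: ler_wpM2r => //.
  apply: le_trans (settle_exp_le _ _ zA f01 sub) _.
  have : stay mu T A 1%g <= eps.
    by apply: stayM; apply: leq_trans (size_cluster _ _ _) _.
  by rewrite /q; lra.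
apply: (@le_trans _ _ (expR U * expword (M * T) (fun u => phi (cluster T M u)))).
  rewrite -expwordZ; apply: ler_expword => u _; rewrite /phi mulrCA -expRD.
  rewrite ler_peMr // -[X in X <= _]expR0 ler_expR subr_ge0.
  exact/fU/cluster_uniq.
rewrite expRD ler_pM2l ?expR_gt0 //; apply: le_trans (main _ (leqnn M)) _.
rewrite -[X in expR X]mulrN expRM_natl; apply: lerXn2r; rewrite ?nnegrE ?expR_ge0 //.
exact: expR_ge1Dx.
Qed.

Lemma grow_far T A (b0 b1 : pred G) (e : R) : b1 1%g ->
  (forall y s, b0 y -> s \in S -> b1 (y * s)%g) ->
  (forall y, ~~ b0 y -> hit mu T 1%g y <= e) ->
  expword T (fun v => (count (predC b1) (grow A v))%:R) <=
    (count (predC b1) A)%:R + e * (count (predC b0) A)%:R.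
Proof.
move=> b11 b01 he.
apply: (@le_trans _ _ (expword T (fun v => (count (predC b1) A)%:R +
    (oapp (predC b1) false (settle A 1%g v))%:R))).
  apply: ler_expword => v _; rewrite /grow; case: settle => [y|] /=.
    by rewrite natrD addrC.
  by rewrite addr0.
rewrite expwordD expword_cst lerD2l.
apply: le_trans (settle_far _ _ b01) _; first by rewrite b11 orbT.
rewrite -sum1_count natr_sum mulr_sumr; apply: ler_sum => y yb.
by rewrite mulr1 he.
Qed.

Lemma cluster_far T M (b : nat -> pred G) (e : nat -> R) k :
  (forall i, b i 1%g) ->
  (forall i y s, b i y -> s \in S -> b i.+1 (y * s)%g) ->
  (forall i y, ~~ b i y -> hit mu T 1%g y <= e i) -> (forall i, 0 <= e i) ->
  expword (M * T) (fun u => (count (predC (b k)) (cluster T M u))%:R) <=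
    M.+1%:R * \prod_(i < k) (M%:R * e i).
Proof.
move=> b1 bS he e0.
suff main m : (m <= M)%N -> expword (m * T) (fun u => (count (predC (b k)) (cluster T m u))%:R) <=
    M.+1%:R * \prod_(i < k) (M%:R * e i) by exact: main.
elim: k m => [|k IHk] m mM.
  rewrite big_ord0 mulr1 -[leRHS](expword_cst (m * T)); apply: ler_expword => u _.
  rewrite ler_nat; apply: leq_trans (count_size _ _) _.
  exact: leq_trans (size_cluster _ _ _) _.
rewrite big_ord_recr /=; set P := \prod_(_ < k) _ in IHk *.
have P0 : 0 <= M.+1%:R * P.
  by rewrite mulr_ge0 // prodr_ge0 // => i _; rewrite mulr_ge0.
apply: (@le_trans _ _ (m%:R * (e k * (M.+1%:R * P)))); last first.
  have -> : M.+1%:R * (P * (M%:R * e k)) = M%:R * (e k * (M.+1%:R * P)) by ring.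
  by rewrite ler_wpM2r ?ler_nat // mulr_ge0.
elim: m mM => [_|m IHm mM]; first by rewrite /= mul0r b1.
rewrite (expword_cluster T m (fun A => (count (predC (b k.+1)) A)%:R)).
apply: le_trans (ler_expword (fun u _ => grow_far (cluster T m u) (b1 k.+1) (@bS k) (@he k))) _.
rewrite expwordD expwordZ -natr1 mulrDl mul1r; apply: lerD; first exact/IHm/ltnW.
by rewrite ler_wpM2l // IHk // ltnW.
Qed.

End Words.

(** * From words to probability spaces *)

Section MeasureLimits.
Context {d : measure_display} {Omega : measurableType d} {R : realType}.
Context (P : probability Omega R).
Local Open Scope ereal_scope.

Lemma measure_bigcup_le (F : (set Omega)^nat) (r : \bar R) :
  (forall n, measurable (F n)) -> {homo F : n m / (n <= m)%N >-> (n <= m)%O} ->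
  (forall n, P (F n) <= r) -> P (\bigcup_n F n) <= r.
Proof.
move=> mF ndF Fr; have mU : measurable (\bigcup_n F n) by exact: bigcup_measurable.
have cv := nondecreasing_cvg_mu (mu := P) mF mU ndF.
rewrite -(cvg_lim _ cv) //; apply: lime_le; first by apply/cvg_ex; exists (P (\bigcup_n F n)).
by apply: nearW.
Qed.

Context (E_ : (set Omega)^nat) (E : set Omega).
Hypothesis mE : forall T, measurable (E_ T).
Hypothesis E_lim : forall w, exists T0, forall T, (T0 <= T)%N -> E_ T w <-> E w.

Lemma eventually_bigcup_bigcap :
  E = \bigcup_n \bigcap_(T in [set T | (n <= T)%N]) E_ T.
Proof.
apply/seteqP; split=> w.
  move=> Ew; have [T0 HT0] := E_lim w; exists T0 => // T /= T0T.
  exact/(HT0 _ T0T).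
move=> [n _ nE]; have [T0 HT0] := E_lim w.
by apply/(HT0 (maxn n T0) (leq_maxr _ _))/nE; exact: leq_maxl.
Qed.

Lemma measurable_eventually : measurable E.
Proof.
rewrite eventually_bigcup_bigcap; apply: bigcup_measurable => n _.
by apply: bigcap_measurable => //; exists n => /=.
Qed.

Lemma measure_eventually_le (T1 : nat) (r : \bar R) :
  (forall T, (T1 <= T)%N -> P (E_ T) <= r) -> P E <= r.
Proof.
move=> le; rewrite eventually_bigcup_bigcap.
have mI n : measurable (\bigcap_(T in [set T | (n <= T)%N]) E_ T).
  by apply: bigcap_measurable => //; exists n => /=.
apply: measure_bigcup_le => // [n m nm|n].
  by apply/subsetPset => w + T /= mT; apply; exact: leq_trans mT.
apply: le_trans (le (maxn n T1) (leq_maxr _ _)).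
apply: le_measure; rewrite ?inE // => w; apply; exact: leq_maxl.
Qed.

End MeasureLimits.

Lemma countable_generated {G : groupType} (S : {fset G}) :
  generates S -> countable [set: G].
Proof.
move=> gen; pose f (w : seq S) := (\big[*%g/1%g]_(y <- [seq val i | i <- w]) y : G).
apply: (@sub_countable _ _ _ [set: seq S]); last exact: countableP.
apply: card_le_trans (card_image_le f _); apply: subset_card_le => x _.
have [n [s [_ sS ->]]] := gen x; exists (pmap insub s) => //; rewrite /f; congr bigop.
rewrite (pmap_filter (insubK _)).
by apply/all_filterP/allP => y /sS yS; rewrite insubT.
Qed.

Section Transfer.
Context {d : measure_display} {Omega : measurableType d} {R : realType}.
Context (P : probability Omega R) {I : choiceType} {G : groupType}.
Context (mu : {fsfun G -> R with 0}) (X : I -> Omega -> G).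
Hypotheses (mu_law : is_law mu) (S_gen : generates (finsupp mu)).
Hypothesis X_iid : iid_of_law P mu X.

Let mX i (A : set G) : measurable (X i @^-1` A).
Proof. by case: X_iid. Qed.

Lemma measurable_word (J : seq I) (Q : seq G -> Prop) :
  measurable [set w | Q [seq X j w | j <- J]].
Proof.
elim: J Q => [|j J IHJ] Q /=.
  have [q|q] := pselect (Q [::]).
    by rewrite (_ : [set _ | _] = setT) //; apply/seteqP; split.
  by rewrite (_ : [set _ | _] = set0) //; apply/seteqP; split.
rewrite (_ : [set _ | _] =
  \bigcup_g (X j @^-1` [set g] `&` [set w | Q (g :: [seq X i w | i <- J])])).
  apply: countable_bigcupT_measurable => [|g]; first exact: countable_generated S_gen.
  by apply: measurableI => //; exact: (IHJ (fun u => Q (g :: u))).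
apply/seteqP; split=> w /=; first by exists (X j w).
by move=> [g _ [/= -> ]].
Qed.

Lemma prob_split j (F : set Omega) : measurable F ->
  P F = (\sum_(g <- finsupp mu) P (F `&` X j @^-1` [set g]))%E.
Proof.
have part (r : seq G) (H : set Omega) : uniq r -> measurable H ->
    P (H `&` X j @^-1` [set` r]) = (\sum_(g <- r) P (H `&` X j @^-1` [set g]))%E.
  elim: r => [|g r IHr] /=.
    move=> _ _; rewrite big_nil (_ : _ `&` _ = set0) ?measure0 //.
    by apply/seteqP; split=> w //= -[].
  move=> /andP[gr ur] mH; rewrite big_cons -IHr // -measureU.
  - congr (P _); apply/seteqP; split=> w /=.
      by move=> [Hw]; rewrite inE => /orP[/eqP ->|]; [left|right].
    by move=> [[Hw ->]|[Hw wr]]; split=> //; rewrite inE ?eqxx // wr orbT.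
  - exact: measurableI.
  - exact: measurableI.
  - apply/seteqP; split=> w //= -[[_ /= Xg] [_ Xr]].
    by move: gr; rewrite -Xg Xr.
have mS : measurable (X j @^-1` [set` finsupp mu]) by [].
have PS : P (X j @^-1` [set` finsupp mu]) = 1%E.
  rewrite -[X in P X]setTI part ?fset_uniq //.
  under eq_bigr do rewrite setTI (let: And3 _ h _ := X_iid in h).
  by rewrite sumEFin mu_law.2.
move=> mF; rewrite -part ?fset_uniq //.
rewrite [LHS](@measureDI _ _ _ _ _ (X j @^-1` [set` finsupp mu])) //.
rewrite [X in (X + _)%E](_ : _ = 0%E) ?add0e //.
apply/eqP; rewrite -measure_le0.
apply: (@le_trans _ _ (P (~` (X j @^-1` [set` finsupp mu])))).
  apply: le_measure; rewrite ?inE; [exact: measurableD|exact: measurableC|].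
  by move=> w [].
by rewrite probability_setC // PS subee.
Qed.

(* In the induction on [J], the cylinder over [K] records the letters already
   read. *)
Lemma prob_cylinder_word (J : seq I) (Q : seq G -> Prop) (K : {fset I})
    (A : I -> set G) : uniq J -> (forall j, j \in J -> j \notin K) ->
  P ((\bigcap_(i in [set` K]) X i @^-1` A i) `&` [set w | Q [seq X j w | j <- J]]) =
  ((\prod_(i <- K) fine (P (X i @^-1` A i))) *
     expword mu (size J) (fun u => (`[< Q u >])%:R))%:E.
Proof.
have prodP (L : {fset I}) (B : I -> set G) :
    P (\bigcap_(i in [set` L]) X i @^-1` B i) =
    (\prod_(i <- L) fine (P (X i @^-1` B i)))%:E.
  case: X_iid => _ _ ->; rewrite -prodEFin; apply: eq_bigr => i _.
  by rewrite fineK // fin_num_measure.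
have mcap (L : {fset I}) (B : I -> set G) :
    measurable (\bigcap_(i in [set` L]) X i @^-1` B i).
  by apply: fin_bigcap_measurable => //; exact: finite_fset.
elim: J Q K A => [|j J IHJ] Q K A /=.
  move=> _ _; have [q|q] := pselect (Q [::]).
    by rewrite (asboolT q) mulr1 (_ : [set w : Omega | Q [::]] = setT) ?setIT ?prodP //; apply/seteqP; split.
  rewrite (asboolF q) mulr0 (_ : [set w : Omega | Q [::]] = set0) ?setI0 ?measure0 //.
  by apply/seteqP; split.
move=> /andP[jJ uJ] JK; rewrite (prob_split j); last first.
  by apply: measurableI => //; exact: (@measurable_word (j :: J) Q).
have jK : j \notin K by rewrite JK // mem_head.
transitivity (\sum_(g <- finsupp mu) ((mu g * \prod_(i <- K) fine (P (X i @^-1` A i))) *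
    expword mu (size J) (fun u => (`[< Q (g :: u) >])%:R))%:E)%E; last first.
  by rewrite sumEFin -avgZ /avg; congr (_%:E); apply: eq_bigr => g _; rewrite mulrA.
apply: eq_bigr => g _; pose B i := if i == j then [set g] else A i.
have -> : \prod_(i <- K) fine (P (X i @^-1` A i)) = \prod_(i <- K) fine (P (X i @^-1` B i)).
  rewrite big_seq [RHS]big_seq; apply: eq_bigr => i iK; rewrite /B.
  by case: eqP => // ij; rewrite -ij iK in jK.
have -> : mu g = fine (P (X j @^-1` B j)).
  by rewrite /B eqxx; case: X_iid => _ -> _.
rewrite -(@big_fsetU1 _ _ _ _ j K (fun i => fine (P (X i @^-1` B i)))) //.
rewrite -(IHJ (fun u => Q (g :: u))) //.
  congr (P _); apply/seteqP; split=> w /=.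
    move=> [[Kw Qw] Xg]; split; last by rewrite -Xg.
    move=> i /=; rewrite !inE => /orP[/eqP ->|iK]; first by rewrite /B eqxx.
    rewrite /B; case: eqP => [ij|_]; first by rewrite -ij iK in jK.
    exact: Kw.
  move=> [Kw Qw]; have Xg : X j w = g.
    by have := Kw j; rewrite /= !inE eqxx /B eqxx; apply.
  split=> //; split; last by rewrite Xg.
  move=> i /= iK; have := Kw i; rewrite /= !inE iK orbT /B.
  case: eqP => [ij|_]; first by rewrite -ij iK in jK.
  by apply.
move=> i iJ; rewrite !inE negb_or JK ?inE ?iJ ?orbT // andbT.
by apply: contraNneq jJ => <-.
Qed.

Lemma prob_word (J : seq I) (Q : seq G -> Prop) : uniq J ->
  P [set w | Q [seq X j w | j <- J]] =
  (expword mu (size J) (fun u => (`[< Q u >])%:R))%:E.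
Proof.
move=> uJ; have := @prob_cylinder_word J Q fset0 (fun=> setT) uJ (fun _ _ => isT).
by rewrite big_seq_fset0 mul1r => <-; congr (P _); apply/seteqP; split=> w //= -[].
Qed.

End Transfer.

(** * Paths of the walk *)

Section Paths.
Context {G : groupType}.
Implicit Types (x y : G) (Xs : nat -> G) (A : seq G).

Lemma walkS x Xs k : walk x Xs k.+1 = walk (x * Xs 0%N)%g (fun j => Xs j.+1) k.
Proof. by elim: k => //= k IHk; rewrite -IHk. Qed.

Lemma mkseqS (T : Type) (f : nat -> T) n :
  mkseq f n.+1 = f 0%N :: mkseq (fun j => f j.+1) n.
Proof. by rewrite /mkseq /= (iotaDl 1 0) -map_comp. Qed.

Fixpoint visits y x (u : seq G) : bool :=
  (x == y) || (if u is s :: v then visits y (x * s)%g v else false).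

Lemma visits_mkseq T y x Xs :
  visits y x (mkseq Xs T) <-> exists2 k, (k <= T)%N & walk x Xs k = y.
Proof.
elim: T x Xs => [|T IHT] x Xs.
  rewrite /= orbF; split=> [/eqP <-|[[|//] _ <-]]; last by rewrite eqxx.
  by exists 0%N.
rewrite mkseqS /=; split.
  move=> /orP[/eqP <-|/IHT[k kT kE]].
    by exists 0%N.
  by exists k.+1; rewrite // walkS.
move=> [[|k] kT yE]; first by rewrite -yE eqxx.
by apply/orP; right; apply/IHT; exists k; rewrite // -walkS.
Qed.

Lemma settle_walk A x Xs k T : (k <= T)%N ->
  (forall j, (j < k)%N -> walk x Xs j \in A) -> walk x Xs k \notin A ->
  settle A x (mkseq Xs T) = Some (walk x Xs k).
Proof.
elim: k x Xs T => [|k IHk] x Xs T kT inA outA.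
  by case: T kT => [|T] _; rewrite ?mkseqS /= (negPf outA).
case: T kT => // T kT; rewrite walkS mkseqS /= (inA 0%N) //; apply: IHk => //.
  by move=> j jk; rewrite -walkS inA.
by rewrite -walkS.
Qed.

Lemma settle_stuck A x Xs T : (forall j, walk x Xs j \in A) ->
  settle A x (mkseq Xs T) = None.
Proof.
elim: T x Xs => [|T IHT] x Xs inA; first by rewrite /= (inA 0%N).
rewrite mkseqS /= (inA 0%N); apply: IHT => j; rewrite -walkS; exact: inA.
Qed.

(* The first particle launched is number 2, since A(1) = {e} is given. *)
Fixpoint labels (T M : nat) : seq (nat * nat) :=
  if M is m.+1 then labels T m ++ [seq (m.+2, k) | k <- iota 0 T] else [::].

Lemma size_labels T M : size (labels T M) = (M * T)%N.
Proof. by elim: M => //= m IHm; rewrite size_cat size_map size_iota IHm mulSn addnC. Qed.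

Lemma labels_uniq T M : uniq (labels T M).
Proof.
have bound m i : i \in labels T m -> (i.1 <= m.+1)%N.
  elim: m => //= m IHm; rewrite mem_cat => /orP[/IHm|/mapP[k _ ->] //].
  by move/leq_trans; apply.
elim: M => //= m IHm; rewrite cat_uniq IHm map_inj_uniq ?iota_uniq; last by move=> a b [].
rewrite andbT; apply/hasPn => i /mapP[k _ ->].
by apply/negP => /bound; rewrite ltnn.
Qed.

Lemma cluster_labels (X : nat * nat -> G) T m :
  cluster T m.+1 [seq X j | j <- labels T m.+1] =
  grow (cluster T m [seq X j | j <- labels T m]) (mkseq (fun k => X (m.+2, k)) T).
Proof.
rewrite /= map_cat -(size_labels T m) -(size_map X) take_size_cat // drop_size_cat //.
by rewrite -map_comp.
Qed.

Lemma cluster_eventually (X : nat -> nat -> G) M : exists T0, forall T, (T0 <= T)%N ->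
  [set` cluster T M [seq X j.1 j.2 | j <- labels T M]] =
  internal_DLA (fun m => walk 1%g (X m)) M.+1.
Proof.
elim: M => [|m [T0 HT0]].
  exists 0%N => T _ /=; apply/seteqP; split=> y /=; rewrite inE; first by move/eqP.
  by move=> ->.
set A := internal_DLA _ m.+1 in HT0.
have -> : internal_DLA (fun m => walk 1%g (X m)) m.+2 =
   A `|` (if hitting_time (walk 1%g (X m.+2)) (~` A) is Some k
             then [set walk 1%g (X m.+2) k] else set0) by [].
have memA T j : (T0 <= T)%N -> (j \in cluster T m [seq X j.1 j.2 | j <- labels T m]) = (j \in A).
  by move=> /HT0 <-; apply/idP/idP; rewrite inE.
rewrite /hitting_time; case: pselect => [h|noh].
  case: ex_minnP => k outA kmin; exists (maxn T0 k) => T; rewrite geq_max => /andP[T0T kT].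
  rewrite (cluster_labels (fun j => X j.1 j.2)) /grow (@settle_walk _ _ _ k) //=.
  - rewrite -(HT0 _ T0T); apply/seteqP; split=> y /=; rewrite inE.
      by move=> /orP[/eqP ->|]; [right|left].
    by move=> [->|->]; rewrite ?orbT ?eqxx.
  - move=> j jk; rewrite memA //; apply: contraT => jA.
    by have := kmin j; rewrite in_setC jA leqNgt jk => /(_ isT).
  - by rewrite memA //; move: outA; rewrite in_setC.
exists T0 => T T0T; rewrite (cluster_labels (fun j => X j.1 j.2)) /grow settle_stuck.
  by rewrite setU0 HT0.
move=> j; rewrite memA //; apply: contraT => jA; case: noh; exists j.
by rewrite in_setC.
Qed.

End Paths.

Section HittingProbability.
Context {d : measure_display} {Omega : measurableType d} {R : realType}.
Context (P : probability Omega R) {G : groupType}.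
Context (mu : {fsfun G -> R with 0}) (Y : nat -> Omega -> G).
Hypotheses (mu_law : is_law mu) (S_gen : generates (finsupp mu)).
Hypothesis Y_iid : iid_of_law P mu Y.
Implicit Types (x y z : G).

Lemma expword_visits T x y :
  expword mu T (fun u => (visits y x u)%:R) = hit mu T x y.
Proof.
elim: T x => [|T IHT] x /=; first by rewrite orbF; case: eqP.
case: eqP => _ /=; last by apply: eq_avg => s _; exact: IHT.
exact: (expword_cst mu_law T.+1).
Qed.

Local Notation F := (hitting_probability P Y).

Let E x y T := [set w | visits y x [seq Y j w | j <- iota 0 T]].

Let PE x y T : P (E x y T) = (hit mu T x y)%:E.
Proof.
rewrite (prob_word mu_law S_gen Y_iid (fun u => visits y x u)) ?iota_uniq //.
by rewrite size_iota -expword_visits; congr (_%:E); apply: eq_expword => u _; rewrite asboolb.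
Qed.

Let mE x y T : measurable (E x y T).
Proof. exact: (measurable_word S_gen Y_iid _ (fun u => visits y x u)). Qed.

Let hit_event x y :
  [set w | hitting_time (walk x (Y^~ w)) [set y] != None] = \bigcup_T E x y T.
Proof.
apply/seteqP; split=> w /=.
  rewrite /hitting_time; case: pselect => // -[k yk] _; exists k => //.
  by apply/(visits_mkseq k y x (Y^~ w)); exists k => //; move: yk; rewrite inE.
move=> [T _ /(visits_mkseq T y x (Y^~ w))[k _ yk]]; rewrite /hitting_time.
by case: pselect => // -[]; exists k; rewrite inE.
Qed.

Let E_nd x y : {homo E x y : n m / (n <= m)%N >-> (n <= m)%O}.
Proof.
move=> n m nm; apply/subsetPset => w /(visits_mkseq n y x (Y^~ w))[k kn yk].
by apply/(visits_mkseq m y x (Y^~ w)); exists k => //; exact: leq_trans nm.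
Qed.

Let F_EFin x y : (F x y)%:E = P (\bigcup_T E x y T).
Proof.
rewrite /hitting_probability hit_event fineK // fin_num_measure //.
exact: bigcup_measurable.
Qed.

Lemma hit_le_hitting T x y : hit mu T x y <= F x y.
Proof.
rewrite -lee_fin F_EFin -PE; apply: le_measure; rewrite ?inE //.
  exact: bigcup_measurable.
exact: bigcup_sup.
Qed.

Lemma hitting_le x y r : (forall T, hit mu T x y <= r) -> F x y <= r.
Proof.
move=> le; rewrite -lee_fin F_EFin; apply: measure_bigcup_le => // T.
by rewrite PE lee_fin.
Qed.

Lemma hitting_ge0 x y : 0 <= F x y.
Proof. exact: le_trans (hit_ge0 mu_law 0 x y) (hit_le_hitting _ _ _). Qed.

Lemma hitting_le1 x y : F x y <= 1.
Proof. by apply: hitting_le => T; exact: hit_le1. Qed.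

Lemma hittingxx x : F x x = 1.
Proof.
by apply/le_anti; rewrite hitting_le1 -(hitxx mu 0 x) hit_le_hitting.
Qed.

Lemma hitting_mul a x y : F (a * x)%g (a * y)%g = F x y.
Proof.
apply/le_anti/andP; split; apply: hitting_le => T.
  by rewrite hit_mul hit_le_hitting.
by rewrite -(hit_mul mu T a) hit_le_hitting.
Qed.

Lemma hitting_trans x y z : F x y * F y z <= F x z.
Proof.
have scale (c b : R) x' y' : 0 <= c -> 0 <= b ->
    (forall T, hit mu T x' y' * c <= b) -> F x' y' * c <= b.
  rewrite le_eqVlt => /orP[/eqP <-|c0] b0 le; first by rewrite mulr0.
  by rewrite -ler_pdivlMr //; apply: hitting_le => T; rewrite ler_pdivlMr.
apply: (scale); rewrite ?hitting_ge0 // => j; rewrite mulrC.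
apply: (scale); rewrite ?hitting_ge0 ?hit_ge0 // => k; rewrite mulrC.
exact: le_trans (hit_trans mu_law j k x y z) (hit_le_hitting _ _ _).
Qed.

Lemma hitting_subharmonic x y : x != y ->
  F x y <= avg mu (fun s => F (x * s)%g y).
Proof.
move=> xy; apply: hitting_le => -[|T] /=; rewrite (negPf xy).
  by apply: avg_ge0 => // s; exact: hitting_ge0.
by apply: ler_avg => // s _; exact: hit_le_hitting.
Qed.

Lemma hitting_step_gt0 s : s \in finsupp mu -> 0 < F 1%g s.
Proof.
move=> sS; apply: lt_le_trans (law_gt0 mu_law sS) _.
by have := hit_step mu_law 1%g sS; rewrite mul1g => /le_trans; apply; exact: hit_le_hitting.
Qed.

Lemma hitting_word (c : R) (w : seq G) : 0 <= c ->
  (forall s, s \in w -> c <= F 1%g s) ->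
  c ^+ size w <= F 1%g (\big[*%g/1%g]_(y <- w) y).
Proof.
move=> c0; elim: w => [|s w IHw] cF; first by rewrite big_nil hittingxx expr0.
rewrite big_cons exprS; set p := (\prod_(_ <- _) _)%g in IHw *.
apply: le_trans (hitting_trans 1%g s (s * p)%g).
rewrite -{2}(mulg1 s) hitting_mul ler_pM ?exprn_ge0 //.
  by rewrite cF // mem_head.
by apply: IHw => t tw; rewrite cF // inE tw orbT.
Qed.

Lemma hitting_gt0 y : 0 < F 1%g y.
Proof.
have [n [w [_ wS ->]]] := S_gen y.
elim: w wS => [|s w IHw] wS; first by rewrite big_nil hittingxx.
rewrite big_cons; set p := (\prod_(_ <- _) _)%g in IHw *.
apply: lt_le_trans (hitting_trans 1%g s (s * p)%g).
rewrite -{2}(mulg1 s) hitting_mul; apply: mulr_gt0.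
  by apply: hitting_step_gt0; rewrite wS ?mem_head.
by apply: IHw => t tw; rewrite wS // inE tw orbT.
Qed.

End HittingProbability.

(** * Hitting balls *)

Lemma ler_sum_uniq_subset {T : eqType} {R : numDomainType} (s t : seq T) (g : T -> R) :
  uniq s -> {subset s <= t} -> (forall x, 0 <= g x) ->
  \sum_(x <- s) g x <= \sum_(x <- t) g x.
Proof.
move=> us; elim: s t us => [|x s IHs] t /=; first by move=> _ _ g0; rewrite big_nil sumr_ge0.
move=> /andP[xs us] st g0; rewrite big_cons [leRHS](big_rem x) ?st ?mem_head //=.
rewrite lerD2l IHs // => y ys; have := st y; rewrite inE ys orbT => /(_ isT).
rewrite (perm_mem (perm_to_rem (st x (mem_head _ _)))) inE => /orP[/eqP yx|//].
by rewrite yx (negPf xs) in ys.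
Qed.

Section HittingBalls.
Context {d : measure_display} {Omega : measurableType d} {R : realType}.
Context (P : probability Omega R) {G : groupType}.
Context (mu : {fsfun G -> R with 0}) (Y : nat -> Omega -> G).
Hypotheses (mu_law : is_law mu) (mu_sym : symmetric_law mu).
Let S := finsupp mu.
Hypotheses (S_gen : generates S) (G_exp : exponential_growth R S).
Hypothesis Y_iid : iid_of_law P mu Y.
Implicit Types (x y z : G) (r a : R) (n : nat) (E : {fset G}).

Local Notation F := (hitting_probability P Y).
Local Notation K := (max_step_distance P Y S).
Local Notation B := (hitting_ball P Y S).
Local Notation V := (ball_volume P Y S).

Let F_gt0 y : 0 < F 1%g y. Proof. exact: (hitting_gt0 mu_law S_gen Y_iid). Qed.

Lemma hitting_ballE r y : B r y <-> expR (- (K * r)) <= F 1%g y.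
Proof.
rewrite /hitting_ball /= /hitting_distance -[X in _ <-> _ <= X]lnK ?posrE //.
by rewrite ler_expR lerNl.
Qed.

Lemma max_step_distance_ge0 : 0 <= K.
Proof.
rewrite /max_step_distance; elim/big_ind: _ => // [x y x0 y0|s _].
  by rewrite le_max x0.
by rewrite /hitting_distance oppr_ge0 ln_le0 // (hitting_le1 mu_law S_gen Y_iid).
Qed.

Lemma step_hitting_ge s : s \in S -> expR (- K) <= F 1%g s.
Proof.
move=> sS; rewrite -[leRHS]lnK ?posrE // ler_expR lerNl.
exact: (@le_bigmax_seq _ _ _ _ _ s xpredT (hitting_distance P Y 1%g)).
Qed.

Lemma hitting_ball1 r : 0 <= r -> B r 1%g.
Proof.
move=> r0; apply/hitting_ballE; rewrite (hittingxx mu_law S_gen Y_iid).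
by rewrite -[leRHS]expR0 ler_expR oppr_le0 mulr_ge0 ?max_step_distance_ge0.
Qed.

Lemma hitting_ball_step r y s : B r y -> s \in S -> B (r + 1) (y * s)%g.
Proof.
move=> /hitting_ballE yr sS; apply/hitting_ballE.
apply: le_trans (hitting_trans mu_law S_gen Y_iid 1%g y (y * s)%g).
rewrite mulrDr mulr1 opprD expRD ler_pM ?expR_ge0 //.
rewrite -{1}(mulg1 y) (hitting_mul mu_law S_gen Y_iid).
exact: step_hitting_ge.
Qed.

Lemma hitting_ball_sub r r' : r <= r' -> B r `<=` B r'.
Proof.
move=> rr' y /hitting_ballE yr; apply/hitting_ballE; apply: le_trans yr.
by rewrite ler_expR lerN2 ler_wpM2l // max_step_distance_ge0.
Qed.

Lemma hitting_volume : exists2 C : R, 0 < C & forall a E, 0 <= a ->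
  (forall x, x \in E -> expR (- a) <= F 1%g x) ->
  #|` E|%:R <= C * (1 + a) ^+ 2 * expR a.
Proof.
have [C C0 HC] := hit_volume mu_law mu_sym S_gen G_exp.
exists (C * 4 * expR 1) => [|a E a0 HE]; first by rewrite !mulr_gt0 ?expR_gt0.
have near x : x \in E -> exists T, expR (- (a + 1)) < hit mu T 1%g x.
  move=> /HE xa; apply: contrapT => none.
  have : F 1%g x <= expR (- (a + 1)).
    apply: (hitting_le mu_law S_gen Y_iid) => T; rewrite leNgt; apply/negP => lt.
    by apply: none; exists T.
  by move/(le_trans xa); rewrite ler_expR; lra.
have [T HT] : exists T, forall x, x \in E -> expR (- (a + 1)) < hit mu T 1%g x.
  suff gen (s : seq G) : {subset s <= E} ->
      exists T, forall x, x \in s -> expR (- (a + 1)) < hit mu T 1%g x by exact: gen.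
  elim: s => [|x s IHs] sE; first by exists 0%N.
  have [|T HT] := IHs; first by move=> y ys; rewrite sE // inE ys orbT.
  have [T' HT'] := near x (sE _ (mem_head _ _)).
  exists (maxn T T') => y; rewrite inE => /orP[/eqP ->|/HT lt].
    by apply: lt_le_trans HT' _; rewrite hit_mono // leq_maxr.
  by apply: lt_le_trans lt _; rewrite hit_mono // leq_maxl.
apply: le_trans (HC T (a + 1) E _ HT) _; first by lra.
rewrite expRD [expR a * _]mulrC mulrA ler_pM2r ?expR_gt0 //.
rewrite [leRHS]mulrAC ler_pM2r ?expR_gt0 // -mulrA ler_pM2l //; nra.
Qed.

Lemma hitting_ball_finite r : 0 <= r -> finite_set (B r).
Proof.
move=> r0; have [C C0 HC] := hitting_volume; apply: contrapT => inf.
set b := C * (1 + K * r) ^+ 2 * expR (K * r).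
have [E EB Eb] := infinite_set_fset (Num.truncn b).+1 inf.
have : #|` E|%:R <= b.
  apply: HC; first by rewrite mulr_ge0 ?max_step_distance_ge0.
  by move=> x xE; apply/hitting_ballE/EB.
apply/negP; rewrite -ltNge; apply: lt_le_trans (truncnS_gt b) _.
by rewrite ler_nat.
Qed.

Lemma in_hitting_ball r y : 0 <= r -> y \in fset_set (B r) <-> B r y.
Proof. by move=> r0; rewrite in_fset_set ?inE //; exact: hitting_ball_finite. Qed.

Lemma max_step_distance_gt0 : 0 < K.
Proof.
rewrite lt_neqAle max_step_distance_ge0 andbT eq_sym; apply/eqP => K0.
have [C C0 HC] := hitting_volume; case: G_exp => c [c0 growth].
have all1 y : expR (- 0) <= F 1%g y.
  have [n [w [_ wS ->]]] := S_gen y; rewrite oppr0 expR0 -(expr1n R (size w)).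
  apply: (hitting_word mu_law S_gen Y_iid) => // s /wS/step_hitting_ge.
  by rewrite K0 oppr0 expR0.
pose n := (Num.truncn (C / c)).+1.
have := HC 0 (fset_set [set x | (word_length S x <= n)%N]) (lexx _) (fun x _ => all1 x).
move/(le_trans (growth n)); rewrite addr0 expr1n expR0 !mulr1; apply/negP; rewrite -ltNge.
apply: lt_le_trans (expR_ge1Dx _); have := truncnS_gt (C / c).
by rewrite ltr_pdivrMr // -/n mulrC => /lt_trans; apply; rewrite ltrDr.
Qed.

Lemma ball_volume_le : exists2 C : R, 0 < C & forall n,
  (V n)%:R <= C * (1 + K * n%:R) ^+ 2 * expR (K * n%:R).
Proof.
have [C C0 HC] := hitting_volume; exists C => // n; apply: HC.
  by rewrite mulr_ge0 ?max_step_distance_ge0.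
by move=> x /in_hitting_ball xB; apply/hitting_ballE/xB.
Qed.

Lemma stay_cvg0 M (eps : R) : 0 < eps -> exists T1, forall T (A : seq G),
  (T1 <= T)%N -> (size A <= M)%N -> stay mu T A 1%g <= eps.
Proof.
move=> eps0; have [C C0 HC] := green_bounded mu_law mu_sym S_gen G_exp.
exists (Num.truncn (M%:R * C / eps)).+1 => T A T1T AM.
have T0 : 0 < T%:R :> R by rewrite ltr0n; exact: leq_trans T1T.
rewrite -(ler_pM2l T0); apply: le_trans (stay_green mu_law T A 1%g) _.
apply: (@le_trans _ _ (M%:R * C)).
  apply: (@le_trans _ _ (\sum_(y <- A) C)); first exact: ler_sum.
  rewrite big_const_seq count_predT iter_addr_0 -[leLHS]mulr_natl.
  by rewrite ler_pM2r // ler_nat.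
rewrite -ler_pdivrMr //; apply: le_trans (ltW (truncnS_gt _)) _.
by rewrite ler_nat.
Qed.

Lemma ball_volume_ge n : expR (K * n%:R) <= (V n.+1)%:R.
Proof.
set b := expR _; have b0 : 0 < b by exact: expR_gt0.
rewrite leNgt; apply/negP => lt; pose A := fset_set (B n%:R).
have gap : 0 < 1 - (V n.+1)%:R / b by rewrite subr_gt0 ltr_pdivrMr // mul1r.
have [|T1 HT1] := @stay_cvg0 (size A) ((1 - (V n.+1)%:R / b) / 2).
  by rewrite divr_gt0.
have := HT1 T1 A (leqnn _) (leqnn _).
have : 1 - stay mu T1 A 1%g <= (V n.+1)%:R / b.
  apply: le_trans (@exit_le_hit _ _ mu mu_law T1 A (fset_set (B n.+1%:R)) 1%g _ _) _.
  - move=> y s /in_hitting_ball yB sS _; apply/in_hitting_ball => //.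
    by rewrite -natr1; apply: hitting_ball_step => //; exact: yB.
  - by right; apply/in_hitting_ball => //; exact: hitting_ball1.
  rewrite /ball_volume -sum1_size natr_sum mulr_suml [leLHS]big_seq_cond [leRHS]big_mkcond /=.
  rewrite [leLHS]big_mkcond /=.
  apply: ler_sum => y _; case: ifP => [/andP[_ yA]|_]; last by rewrite divr_ge0 // ltW.
  apply: le_trans (hit_le_hitting mu_law S_gen Y_iid _ _ _) _.
  rewrite mul1r -expRN ltW // ltNge; apply: contra yA => yb.
  by apply/in_hitting_ball => //; apply/hitting_ballE.
by move: gap; lra.
Qed.

Lemma ball_hitting_sum : exists2 C : R, 0 < C & forall n,
  \sum_(x <- fset_set (B n%:R)) F 1%g x <= C * n.+1%:R * (1 + K * n%:R) ^+ 2.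
Proof.
have [C C0 HC] := ball_volume_le; have K0 := max_step_distance_ge0.
exists (C * expR K) => [|n]; first by rewrite mulr_gt0 ?expR_gt0.
have F0 x : 0 <= F 1%g x by exact: ltW.
have eK : 1 <= expR K by rewrite -expR0 ler_expR.
elim: n => [|n IHn].
  rewrite mulr0 addr0 expr1n !mulr1; apply: (@le_trans _ _ C); last by rewrite ler_pMr.
  apply: (@le_trans _ _ (V 0)%:R).
    rewrite /ball_volume -sum1_size natr_sum; apply: ler_sum => x _.
    exact: (hitting_le1 mu_law S_gen Y_iid).
  by apply: le_trans (HC 0) _; rewrite mulr0 addr0 expr1n expR0 !mulr1.
rewrite (bigID (fun x => x \in fset_set (B n%:R))) /=.
have inner : \sum_(x <- fset_set (B n.+1%:R) | x \in fset_set (B n%:R)) F 1%g x <=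
    C * expR K * n.+1%:R * (1 + K * n.+1%:R) ^+ 2.
  apply: (@le_trans _ _ (\sum_(x <- fset_set (B n%:R)) F 1%g x)).
    rewrite -big_filter; apply: ler_sum_uniq_subset => //.
      by rewrite filter_uniq ?fset_uniq.
    by move=> x; rewrite mem_filter => /andP[].
  apply: le_trans IHn _; rewrite ler_pM2l ?mulr_gt0 ?expR_gt0 //.
  have Kn : 0 <= K * n%:R by rewrite mulr_ge0.
  rewrite ler_pXn2r ?nnegrE ?addr_ge0 ?mulr_ge0 //.
  by rewrite lerD2l ler_wpM2l // ler_nat.
have outer : \sum_(x <- fset_set (B n.+1%:R) | x \notin fset_set (B n%:R)) F 1%g x <=
    C * expR K * (1 + K * n.+1%:R) ^+ 2.
  apply: (@le_trans _ _ ((V n.+1)%:R * expR (- (K * n%:R)))).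
    rewrite /ball_volume -sum1_size natr_sum mulr_suml big_mkcond.
    apply: ler_sum => x _; rewrite mul1r; case: ifPn => [xn|_]; last exact: expR_ge0.
    rewrite ltW // ltNge; apply: contra xn => xn.
    by apply/in_hitting_ball => //; apply/hitting_ballE.
  rewrite expRN ler_pdivrMr ?expR_gt0 //; apply: le_trans (HC n.+1) _.
  rewrite -(natr1 n) [K * (_ + _)]mulrDr mulr1 expRD.
  by rewrite le_eqVlt; apply/orP; left; apply/eqP; ring.
rewrite -(natr1 n.+1); move: inner outer; set q := (_ ^+ 2); set c := C * expR K.
by rewrite [c * (_ + 1)]mulrDr mulr1 [(_ + c) * q]mulrDl; exact: lerD.
Qed.

End HittingBalls.

(** * Bad events *)

Section ClusterProbability.
Context {R : realType} {G : groupType} (mu : {fsfun G -> R with 0}).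
Hypotheses (mu_law : is_law mu) (mu_sym : symmetric_law mu).
Let S := finsupp mu.
Hypotheses (S_gen : generates S) (G_exp : exponential_growth R S).
Context {d0 : measure_display} {Omega0 : measurableType d0}.
Context (P0 : probability Omega0 R) (Y : nat -> Omega0 -> G).
Hypothesis Y_iid : iid_of_law P0 mu Y.
Context {d : measure_display} {Omega : measurableType d}.
Context (P : probability Omega R) (X : nat -> nat -> Omega -> G).
Hypothesis X_iid : iid_of_law P mu (fun nk : nat * nat => X nk.1 nk.2).
Implicit Types (x y z : G) (r : R) (n k M T : nat) (Q : set G -> Prop).

Local Notation F := (hitting_probability P0 Y).
Local Notation K := (max_step_distance P0 Y S).
Local Notation B := (hitting_ball P0 Y S).
Local Notation V := (ball_volume P0 Y S).
Local Notation DLA n w := (internal_DLA (fun m => walk 1%g (fun k => X m k w)) n).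

Let E Q M T :=
  [set w | Q [set` cluster T M [seq X j.1 j.2 w | j <- labels T M]]].

Let mE Q M T : measurable (E Q M T).
Proof.
exact: (measurable_word S_gen X_iid (labels T M) (fun u => Q [set` cluster T M u])).
Qed.

Let PE Q M T : P (E Q M T) =
  (expword mu (M * T) (fun u => (`[< Q [set` cluster T M u] >])%:R))%:E.
Proof.
by rewrite -(size_labels T M) -(prob_word mu_law S_gen X_iid _ (labels_uniq T M)).
Qed.

Let E_lim Q M w : exists T0, forall T, (T0 <= T)%N -> E Q M T w <-> Q (DLA M.+1 w).
Proof.
have [T0 HT0] := cluster_eventually (fun m k => X m k w) M.
by exists T0 => T /HT0 <-.
Qed.

Lemma measurable_DLA Q M : measurable [set w | Q (DLA M.+1 w)].
Proof. exact: (measurable_eventually (mE Q M) (E_lim Q M)). Qed.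

Lemma ball_missed n r M T z (phi := expR (- (K * r)) - expR (- (K * n%:R))) :
  0 < phi -> (forall A, (size A <= M)%N -> stay mu T A 1%g <= phi / 2) -> B r z ->
  expword mu (M * T) (fun u => (z \notin cluster T M u)%:R) <=
    expR (\sum_(x <- fset_set (B n%:R)) F 1%g x - M%:R * (phi / 4)).
Proof.
move=> phi0 stayM zr; have F0 x y : 0 <= F x y.
  exact: (hitting_ge0 mu_law S_gen Y_iid).
pose b := expR (- (K * n%:R)).
pose f y := Num.max (F y z - b) 0.
have f1 : phi <= f 1%g.
  by rewrite le_max lerD2r; move/(hitting_ballE mu_law S_gen Y_iid): zr => ->.
apply: le_trans (cluster_miss mu_law (f := f) (eps := phi / 2)
  (U := \sum_(x <- fset_set (B n%:R)) F 1%g x) _ _ _ stayM _) _.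
- move=> y; rewrite le_max lexx orbT ge_max ler01 andbT.
  apply: (@le_trans _ _ (F y z)); last exact: (hitting_le1 mu_law S_gen Y_iid).
  by rewrite gerBl expR_ge0.
- move=> y yz; rewrite ge_max; apply/andP; split; last first.
    by apply: avg_ge0 => // s; rewrite le_max lexx orbT.
  apply: (@le_trans _ _ (avg mu (fun s => F (y * s)%g z + - b))).
    rewrite avgD (avg_cst mu_law) lerD2r.
    exact: (hitting_subharmonic mu_law S_gen Y_iid).
  by apply: ler_avg => // s _; rewrite le_max lexx.
- by rewrite divr_ge0 // ltW.
- move=> A uA; pose h y := (y^-1 * z)%g.
  have Fh y : F y z = F 1%g (h y).
    by rewrite -(hitting_mul mu_law S_gen Y_iid y 1%g) mulg1 mulVKg.
  apply: (@le_trans _ _ (\sum_(y <- A | h y \in fset_set (B n%:R)) F 1%g (h y))).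
    rewrite [leRHS]big_mkcond; apply: ler_sum => y _; rewrite /f Fh.
    case: ifPn => yB.
      by rewrite ge_max -Fh F0 andbT gerBl expR_ge0.
    rewrite ge_max lexx andbT subr_le0 leNgt; apply: contra yB => /ltW yB.
    apply/(in_hitting_ball mu_law mu_sym S_gen G_exp Y_iid) => //.
    exact/(hitting_ballE mu_law S_gen Y_iid).
  rewrite -big_filter -(big_map h xpredT (F 1%g)); apply: ler_sum_uniq_subset => //.
    rewrite map_inj_uniq ?filter_uniq // => y y' /mulIg; exact: invg_inj.
  by move=> x /mapP[y]; rewrite mem_filter => /andP[yB _] ->.
rewrite ler_expR lerD2l lerN2; apply: ler_wpM2l => //.
by move: f1; lra.
Qed.

Lemma DLA_bad_prob n r k : r < n%:R ->
  (P [set w | ~ (B r `<=` DLA (V n) w /\ DLA (V n) w `<=` B (n + k)%:R)] <=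
  ((V n)%:R * expR (\sum_(x <- fset_set (B n%:R)) F 1%g x -
      ((V n)%:R - 1) * ((expR (- (K * r)) - expR (- (K * n%:R))) / 4)) +
   (V n)%:R * \prod_(i < k) ((V n)%:R * expR (- (K * (n + i)%:R))))%:E)%E.
Proof.
move=> rn; have K0 := max_step_distance_gt0 mu_law mu_sym S_gen G_exp Y_iid.
have in_ball := in_hitting_ball mu_law mu_sym S_gen G_exp Y_iid.
have V0 : (0 < V n)%N.
  rewrite /ball_volume cardfs_gt0; apply/fset0Pn; exists 1%g.
  by apply/in_ball => //; exact: (hitting_ball1 mu_law S_gen Y_iid).
set phi := expR (- (K * r)) - _; have phi0 : 0 < phi.
  by rewrite subr_gt0 ltr_expR ltrN2 ltr_pM2l.
pose Q (a : set G) := ~ (B r `<=` a /\ a `<=` B (n + k)%:R).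
pose M := (V n).-1; have MV : V n = M.+1 by rewrite prednK.
have [T1 HT1] := @stay_cvg0 _ _ _ mu_law mu_sym S_gen G_exp M (phi / 2) (divr_gt0 phi0 (ltr0Sn _ 1)).
rewrite [in X in (X <= _)%E]MV.
apply: (measure_eventually_le (mE Q M) (E_lim Q M) (T1 := T1)) => T T1T.
rewrite PE lee_fin.
have Br_sub : B r `<=` B n%:R.
  by apply: (hitting_ball_sub mu_law S_gen Y_iid); exact: ltW.
have Bn_fin := hitting_ball_finite mu_law mu_sym S_gen G_exp Y_iid (ler0n R n).
have Br_fin : finite_set (B r) by exact: sub_finite_set Bn_fin.
pose b i := [pred y | `[< B (n + i)%:R y >]].
apply: (@le_trans _ _ (expword mu (M * T) (fun u =>
    \sum_(z <- fset_set (B r)) (z \notin cluster T M u)%:R +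
    (count (predC (b k)) (cluster T M u))%:R))).
  apply: ler_expword => // u _; case: asboolP => [Qu|_]; last first.
    by rewrite addr_ge0 // sumr_ge0.
  have [[z zr zu]|all_in] := pselect (exists2 z, B r z & z \notin cluster T M u).
    have zB : z \in fset_set (B r) by rewrite in_fset_set // inE.
    by rewrite (big_rem z) //= zu -addrA lerDl addr_ge0 // sumr_ge0.
  have [has_out|none] := boolP (has (predC (b k)) (cluster T M u)).
    by rewrite -[leLHS]add0r lerD ?sumr_ge0 // ler1n -has_count.
  case: Qu; split=> y /=; last first.
    by move=> yu; move/hasPn: none => /(_ y yu); rewrite negbK => /asboolP.
  by move=> yr; apply: contraT => yu; case: all_in; exists y.
rewrite expwordD expword_sum //; apply: lerD.
  apply: (@le_trans _ _ (\sum_(z <- fset_set (B r))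
     expR (\sum_(x <- fset_set (B n%:R)) F 1%g x - M%:R * (phi / 4)))).
    rewrite big_seq [leRHS]big_seq; apply: ler_sum => z; rewrite in_fset_set // inE => zr.
    by apply: ball_missed => // A AM; exact: HT1.
  rewrite big_const_seq count_predT iter_addr_0 -[leLHS]mulr_natl.
  have -> : (V n)%:R - 1 = M%:R :> R by rewrite MV -natr1 addrK.
  rewrite ler_pM2r ?expR_gt0 // ler_nat /ball_volume; apply: fsubset_leq_card.
  by rewrite -fset_set_sub.
apply: le_trans (cluster_far mu_law (T := T) M (b := b) k (e := fun i => expR (- (K * (n + i)%:R))) _ _ _ _) _.
- by move=> i; apply/asboolP; exact: (hitting_ball1 mu_law S_gen Y_iid).
- move=> i y s /asboolP yB sS; apply/asboolP; rewrite addnS -natr1.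
  exact: (hitting_ball_step mu_law S_gen Y_iid).
- move=> i y /asboolP yB; apply: le_trans (hit_le_hitting mu_law S_gen Y_iid _ _ _) _.
  rewrite leNgt; apply/negP => lt; apply: yB.
  by apply/(hitting_ballE mu_law S_gen Y_iid)/ltW.
- by move=> i; exact: expR_ge0.
rewrite -MV ler_wpM2l //; apply: ler_prod => i _.
by rewrite mulr_ge0 ?expR_ge0 //= ler_wpM2r ?expR_ge0 // ler_nat MV.
Qed.

End ClusterProbability.

(** * Asymptotics and conclusion *)

Section Asymptotics.
Context {R : realType}.

Lemma eventually_ge (y : R) : exists N, forall n, (N <= n)%N -> y <= n%:R.
Proof.
exists (Num.truncn y).+1 => n Nn; apply: le_trans (ltW (truncnS_gt y)) _.
by rewrite ler_nat.
Qed.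

Lemma le_expR (x : R) : x <= expR x.
Proof. by have := expR_ge1Dx x; lra. Qed.

Context (K C1 C2 : R) (V W : nat -> R).
Hypotheses (K0 : 0 < K) (C10 : 0 < C1) (C20 : 0 < C2).
Hypothesis V_le : forall n, V n <= C1 * (1 + K * n%:R) ^+ 2 * expR (K * n%:R).
Hypothesis V_ge : forall n, expR (K * n%:R) <= V n.+1.
Hypothesis W_le : forall n, W n <= C2 * n.+1%:R * (1 + K * n%:R) ^+ 2.

Lemma inner_bound (C_I : R) : 3 / K < C_I -> exists N, forall n, (N <= n)%N ->
  n%:R - C_I * ln n%:R < n%:R /\
  V n * expR (W n - (V n - 1) *
    ((expR (- (K * (n%:R - C_I * ln n%:R))) - expR (- (K * n%:R))) / 4)) <=
  expR (- n%:R).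
Proof.
rewrite ltr_pdivrMr // mulrC => p3; set p := K * C_I in p3.
have C_I0 : 0 < C_I by rewrite -(pmulr_rgt0 _ K0) -/p; lra.
pose D1 := C1 + 3 * K; pose D2 := 2 * C2 * (1 + K) ^+ 2.
pose c := expR (- K) / 8; have c0 : 0 < c by rewrite divr_gt0 ?expR_gt0.
pose A := (D1 + D2 + 1) / c.
have D20 : 0 < D2 by rewrite /D2 !mulr_gt0 ?exprn_gt0 ?addr_gt0.
have A0 : 0 < A by rewrite divr_gt0 // !addr_gt0 // mulr_gt0.
have [N1 HN1] := eventually_ge (2 + K^-1).
have [N2 HN2] := eventually_ge (expR (A / (p - 3))).
exists (maxn N1 N2) => n; rewrite geq_max => /andP[/HN1 n1 /HN2 n2].
set x := n%:R : R in n1 n2 *.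
have iK : 0 < K^-1 by rewrite invr_gt0.
have x1 : 1 <= x by lra.
have x0 : 0 < x by lra.
have lnx : A <= (p - 3) * ln x.
  by rewrite -ler_pdivrMl ?subr_gt0 // mulrC -ler_expR lnK.
have ln0 : 0 < ln x.
  have : 0 < (p - 3) * ln x by apply: lt_le_trans lnx.
  by rewrite pmulr_rgt0 // subr_gt0.
split; first by rewrite gtrBl mulr_gt0.
have C1' := ltW C10; have C2' := ltW C20; have K' := ltW K0; have x' := ltW x0.
have Kx : 0 <= K * x by exact: mulr_ge0.
have Kx1 : 0 <= 1 + K * x by exact: addr_ge0.
have K1 : 0 <= 1 + K by exact: addr_ge0.
have x3 : x <= x ^+ 3.
  by rewrite -[leLHS]mulr1 exprS ler_pM2l // exprn_ege1.
have x30 : 1 <= x ^+ 3 by exact: exprn_ege1.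
have Vup : V n <= expR (D1 * x ^+ 3).
  apply: le_trans (V_le n) _; rewrite -/x.
  apply: (@le_trans _ _ (expR C1 * expR (K * x) ^+ 2 * expR (K * x))).
    rewrite ler_pM2r ?expR_gt0 //; apply: ler_pM; rewrite ?exprn_ge0 ?le_expR //.
    by rewrite ler_pXn2r ?nnegrE ?expR_ge0 ?expR_ge1Dx.
  rewrite -expRM_natl -!expRD ler_expR /D1.
  have : C1 <= C1 * x ^+ 3 by rewrite ler_peMr // ltW.
  have : K * x <= K * x ^+ 3 by rewrite ler_pM2l.
  by lra.
have Wup : W n <= D2 * x ^+ 3.
  apply: le_trans (W_le n) _; rewrite -natr1 -/x.
  have -> : D2 * x ^+ 3 = C2 * (2 * x) * ((1 + K) * x) ^+ 2 by rewrite /D2; ring.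
  apply: ler_pM; rewrite ?exprn_ge0 ?mulr_ge0 ?addr_ge0 //.
    by rewrite ler_pM2l //; lra.
  by rewrite ler_pXn2r ?nnegrE ?mulr_ge0 //; lra.
have Vlow : 4 * c * expR (K * x) <= V n - 1.
  have n0 : (0 < n)%N by rewrite -(ltr_nat R).
  have := V_ge n.-1; rewrite prednK // => Vn.
  have pn : n.-1%:R = x - 1 :> R by rewrite /x -[in RHS](prednK n0) -natr1 addrK.
  rewrite pn mulrBr mulr1 in Vn.
  have big : 1 <= K * x - K.
    have : K * (2 + K^-1) <= K * x by rewrite ler_pM2l.
    by rewrite mulrDr divff ?gt_eqF //; lra.
  have := expR_ge1Dx (K * x - K).
  rewrite /c; have -> : 4 * (expR (- K) / 8) * expR (K * x) = expR (K * x - K) / 2.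
    by rewrite expRD; field.
  by lra.
have drop : expR (- (K * (x - C_I * ln x))) - expR (- (K * x)) =
    expR (- (K * x)) * (expR (p * ln x) - 1).
  by rewrite [RHS]mulrBr mulr1 -expRD /p; congr (expR _ - _); ring.
have pow : A * x ^+ 3 <= expR (p * ln x) - 1.
  have -> : p * ln x = 3%:R * ln x + (p - 3) * ln x by ring.
  rewrite expRD expRM_natl lnK ?posrE //.
  have := expR_ge1Dx ((p - 3) * ln x) => e1.
  have : x ^+ 3 * (1 + A) <= x ^+ 3 * expR ((p - 3) * ln x).
    by rewrite ler_pM2l ?exprn_gt0 //; lra.
  by rewrite mulrDr mulr1; lra.
have gain : c * A * x ^+ 3 <= (V n - 1) *
    ((expR (- (K * (x - C_I * ln x))) - expR (- (K * x))) / 4).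
  rewrite drop; apply: (@le_trans _ _ ((4 * c * expR (K * x)) *
     (expR (- (K * x)) * (expR (p * ln x) - 1) / 4))).
    have -> : 4 * c * expR (K * x) * (expR (- (K * x)) * (expR (p * ln x) - 1) / 4) =
       c * (expR (K * x) * expR (- (K * x))) * (expR (p * ln x) - 1) by field.
    rewrite -expRD subrr expR0 mulr1 -mulrA ler_pM2l //.
  apply: ler_wpM2r => //.
  rewrite divr_ge0 // mulr_ge0 ?expR_ge0 //; apply: le_trans pow.
  by rewrite mulr_ge0 ?exprn_ge0 // ltW.
have cA : c * A = D1 + D2 + 1 by rewrite /A mulrC divfK // gt_eqF.
rewrite cA in gain.
apply: (@le_trans _ _ (expR (D1 * x ^+ 3) * expR (D2 * x ^+ 3 - (D1 + D2 + 1) * x ^+ 3))).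
  apply: ler_pM => //; rewrite ?expR_ge0 //.
    by apply: le_trans (expR_ge0 (K * n.-1%:R)) _; rewrite -[X in V X](@prednK n) // -(ltr_nat R).
  by rewrite ler_expR; lra.
by rewrite -expRD ler_expR; lra.
Qed.

Lemma outer_bound (C_O : R) : 2 < C_O -> exists N, forall n, (N <= n)%N ->
  exists2 k, k%:R <= C_O * Num.sqrt n%:R &
    V n * \prod_(i < k) (V n * expR (- (K * (n + i)%:R))) <=
    expR (- (K / 2 * n%:R)).
Proof.
move=> C_O2; pose c1 := C1 * (1 + K) ^+ 2.
have c10 : 0 < c1 by rewrite mulr_gt0 // exprn_gt0 // addr_gt0.
pose D := (C_O + 1) * (c1 + 8) + K * C_O / 2.
have D0 : 0 < D by rewrite addr_gt0 ?mulr_gt0 ?invr_gt0 //; lra.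
pose T0 := 1 + 2 * D / K + (C_O - 2)^-1.
have CO2 : 0 < (C_O - 2)^-1 by rewrite invr_gt0 subr_gt0.
have DK0 : 0 < 2 * D / K by rewrite divr_gt0 // mulr_gt0.
have [N HN] := eventually_ge (T0 ^+ 4).
exists N => n /HN; set x := n%:R : R => Tx.
have T00 : 0 < T0 by rewrite /T0; lra.
have x0 : 0 < x by apply: lt_le_trans Tx; rewrite exprn_gt0.
pose t := Num.sqrt (Num.sqrt x).
have t2 : t ^+ 2 = Num.sqrt x by rewrite sqr_sqrtr // sqrtr_ge0.
have t4 : t ^+ 4 = x.
  by rewrite (exprM t 2 2) t2 sqr_sqrtr // ltW.
have tT : T0 <= t.
  rewrite leNgt; apply/negP => lt; have : t ^+ 4 < T0 ^+ 4.
    by rewrite ltr_pXn2r ?nnegrE ?sqrtr_ge0 // ltW.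
  by rewrite t4 ltNge Tx.
have t0 : 0 <= t by exact: sqrtr_ge0.
have t1 : 1 <= t by rewrite /T0 in tT; lra.
have tD : D <= K / 2 * t.
  have : 2 * D / K <= t by rewrite /T0 in tT; lra.
  by rewrite ler_pdivrMr //; lra.
have tC : 2 * t ^+ 2 <= C_O * t ^+ 2 - 1.
  have : (C_O - 2)^-1 <= t by rewrite /T0 in tT; lra.
  rewrite -[X in X <= _]mul1r ler_pdivrMr ?subr_gt0 // => h.
  have : t <= t ^+ 2 by rewrite expr2; nra.
  by nra.
have Ct0 : 0 <= C_O * t ^+ 2 by rewrite mulr_ge0 ?exprn_ge0 //; lra.
pose k := Num.truncn (C_O * t ^+ 2).
have k_le : k%:R <= C_O * t ^+ 2 by rewrite truncn_le.
have k_ge : 2 * t ^+ 2 <= k%:R.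
  by have := truncnS_gt (C_O * t ^+ 2); rewrite -/k -natr1; lra.
exists k; first by rewrite -t2.
pose L := c1 + 8 * t.
have Vup : V n <= expR (L + K * x).
  apply: le_trans (V_le n) _; rewrite -/x expRD ler_pM2r ?expR_gt0 //.
  have x1 : 1 <= x by rewrite -t4 exprn_ege1.
  apply: (@le_trans _ _ (c1 * t ^+ 8)).
    rewrite /c1 -mulrA ler_pM2l // (exprM t 4 2) t4 -exprMn.
    have Kx := mulr_gt0 K0 x0.
    have h1 : 0 <= 1 + K * x by rewrite addr_ge0 // ltW.
    have h2 : 0 <= (1 + K) * x by rewrite ltW // mulr_gt0 // addr_gt0.
    by rewrite ler_pXn2r ?nnegrE //; lra.
  rewrite /L expRD expRM_natl; apply: ler_pM; rewrite ?exprn_ge0 ?le_expR //.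
  - exact: ltW.
  - by rewrite ler_pXn2r ?nnegrE ?expR_ge0 ?le_expR.
have V0 : 0 <= V n.
  have n0 : (0 < n)%N by rewrite -(ltr_nat R).
  by apply: le_trans (expR_ge0 (K * n.-1%:R)) _; rewrite -[X in V X](@prednK n).
have prod_le j : \prod_(i < j) (V n * expR (- (K * (n + i)%:R))) <=
    expR (j%:R * L - K * (j%:R * (j%:R - 1) / 2)).
  elim: j => [|j IHj]; first by rewrite big_ord0 !mul0r mulr0 subr0 expR0.
  rewrite big_ord_recr /=.
  have -> : j.+1%:R * L - K * (j.+1%:R * (j.+1%:R - 1) / 2) =
     (j%:R * L - K * (j%:R * (j%:R - 1) / 2)) + (L - K * j%:R).
    by rewrite -natr1; field.
  rewrite expRD; apply: ler_pM => //.
  - by apply: prodr_ge0 => i _; rewrite mulr_ge0 ?expR_ge0.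
  - by rewrite mulr_ge0 ?expR_ge0.
  - have -> : L - K * j%:R = (L + K * x) - K * (n + j)%:R by rewrite natrD -/x; ring.
    by rewrite [leRHS]expRD ler_wpM2r ?expR_ge0.
apply: (@le_trans _ _ (expR (L + K * x) * expR (k%:R * L - K * (k%:R * (k%:R - 1) / 2)))).
  apply: ler_pM => //; apply: prodr_ge0 => i _.
  by rewrite mulr_ge0 ?expR_ge0.
rewrite -expRD ler_expR.
have kL : (k%:R + 1) * L <= (C_O + 1) * (c1 + 8) * t ^+ 3.
  have -> : (C_O + 1) * (c1 + 8) * t ^+ 3 = ((C_O + 1) * t ^+ 2) * ((c1 + 8) * t) by ring.
  apply: ler_pM.
  - by rewrite addr_ge0.
  - by apply: addr_ge0; [exact: ltW|exact: mulr_ge0].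
  - have : 1 <= t ^+ 2 by exact: exprn_ege1.
    by lra.
  - by rewrite /L [leRHS]mulrDl lerD2r ler_peMr // ltW.
have k2 : 4 * x <= k%:R * k%:R.
  have -> : 4 * x = (2 * t ^+ 2) * (2 * t ^+ 2) by rewrite -t4; ring.
  by apply: ler_pM => //; rewrite mulr_ge0 ?exprn_ge0 ?sqrtr_ge0.
have kk : K * (k%:R * (k%:R - 1) / 2) >= 2 * K * x - K * C_O / 2 * t ^+ 3.
  have t23 : t ^+ 2 <= t ^+ 3 by rewrite [leRHS]exprSr ler_peMr // exprn_ge0.
  have le3 : k%:R <= C_O * t ^+ 3 by apply: le_trans k_le _; rewrite ler_pM2l //; lra.
  have -> : 2 * K * x - K * C_O / 2 * t ^+ 3 = K * ((4 * x - C_O * t ^+ 3) / 2) by field.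
  by rewrite ler_pM2l //; lra.
have fin : D * t ^+ 3 <= K / 2 * x.
  have -> : K / 2 * x = (K / 2 * t) * t ^+ 3 by rewrite -t4; ring.
  by rewrite ler_wpM2r ?exprn_ge0.
by move: kL kk fin; rewrite /D mulrDl mulrDl mul1r; lra.
Qed.

End Asymptotics.

Section BorelCantelli.
Context {d : measure_display} {Omega : measurableType d} {R : realType}.
Context (P : probability Omega R).

Lemma geometric_Borel_Cantelli (F : (set Omega)^nat) (kappa : R) (N : nat) :
  0 < kappa -> (forall n, measurable (F n)) ->
  (forall n, (N <= n)%N -> (P (F n) <= (2 * expR (- (kappa * n%:R)))%:E)%E) ->
  P [set w | exists n0 : nat, forall n : nat, (n0 < n)%N -> ~ F n w] = 1%E.
Proof.
move=> kappa0 mF PF; pose H n := if (N <= n)%N then F n else set0.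
have mH n : measurable (H n) by rewrite /H; case: ifP.
pose q := expR (- kappa); have q1 : q < 1.
  by rewrite /q -[ltRHS]expR0 ltr_expR oppr_lt0.
have q0 : 0 <= q by exact: expR_ge0.
have PH n : (P (H n) <= (2 * q ^+ n)%:E)%E.
  rewrite /H; case: ifP => [/PF|_].
    by rewrite /q -expRM_natl mulrN (mulrC n%:R).
  by rewrite measure0 lee_fin mulr_ge0 ?exprn_ge0.
have sum_fin : (\big[+%E/0%R]_(0 <= n <oo) P (H n) < +oo)%E.
  apply: (@le_lt_trans _ _ ((2 / (1 - q))%:E)); last exact: ltry.
  apply: lime_le; first by apply: is_cvg_nneseries => n _ _; exact: measure_ge0.
  apply: nearW => n; apply: le_trans (lee_sum _ (fun i _ => PH i)) _.
  rewrite sumEFin lee_fin -mulr_sumr ler_pM2l // -[leRHS]mul1r ler_pdivlMr ?subr_gt0 //.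
  rewrite big_mkord mulrC.
  have := subrX1 q n; rewrite -opprB -[q - 1]opprB mulNr => /oppr_inj <-.
  by rewrite gerBl exprn_ge0.
have lim0 := lim_sup_set_cvg0 mH sum_fin.
rewrite (_ : [set _ | _] = ~` lim_sup_set H).
  rewrite probability_setC ?lim0 ?sube0 //.
  apply: bigcap_measurable => [|n _]; first by exists 0%N.
  exact: bigcup_measurable.
apply/seteqP; split=> w.
  move=> [n0 nF] /(_ (maxn N n0.+1) I)[j /=]; rewrite geq_max => /andP[Nj n0j].
  by rewrite /H Nj; exact: nF.
move=> nlim; apply: contrapT => none; apply: nlim => m _; apply: contrapT => noj.
apply: none; exists (maxn N m) => n; rewrite gtn_max => /andP[Nn mn] Fn.
by apply: noj; exists n; [exact: ltnW|rewrite /H ltnW].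
Qed.

End BorelCantelli.

(* The walk with increments [Y] realizes the hitting distance; the walks with
   increments [X n] are the independent copies that build the cluster. *)
Theorem theorem3p1 (R : realType) (G : groupType)
    (mu : {fsfun G -> R with 0})
    (mu_law : is_law mu) (mu_sym : symmetric_law mu)
    (S_sym : symmetric_fset (finsupp mu)) (S_gen : generates (finsupp mu))
    (G_exp : exponential_growth R (finsupp mu))
    (d0 : measure_display) (Omega0 : measurableType d0)
    (P0 : probability Omega0 R) (Y : nat -> Omega0 -> G)
    (Y_iid : iid_of_law P0 mu Y)
    (d : measure_display) (Omega : measurableType d)
    (P : probability Omega R) (X : nat -> nat -> Omega -> G)
    (X_iid : iid_of_law P mu (fun nk : nat * nat => X nk.1 nk.2))
    (C_I C_O : R) :
  let S := finsupp mu in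
  let K := max_step_distance P0 Y S in
  let B := hitting_ball P0 Y S in
  let V := ball_volume P0 Y S in
  let A n w := internal_DLA (fun m => walk 1%g (fun k => X m k w)) n in
  3 / K < C_I -> 2 < C_O ->
  P [set w | exists n0 : nat, forall n : nat, (n0 < n)%N ->
      B (n%:R - C_I * ln n%:R) `<=` A (V n) w /\
      A (V n) w `<=` B (n%:R + C_O * Num.sqrt n%:R)] = 1%E.
Proof.
move=> S K B V A CI CO.
have K0 : 0 < K by exact: (max_step_distance_gt0 mu_law mu_sym S_gen G_exp Y_iid).
have [C1 C10 V_le] := ball_volume_le mu_law mu_sym S_gen G_exp Y_iid.
have [C2 C20 W_le] := ball_hitting_sum mu_law mu_sym S_gen G_exp Y_iid.
have V_ge := ball_volume_ge mu_law mu_sym S_gen G_exp Y_iid.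
have [N1 inner] := inner_bound K0 C10 C20 V_le V_ge W_le CI.
have [N2 outer] := outer_bound K0 C10 V_le V_ge CO.
have V0 n : (0 < V n.+1)%N.
  by rewrite -(ltr_nat R); apply: lt_le_trans (V_ge n); exact: expR_gt0.
pose Q n (a : set G) := ~ (B (n%:R - C_I * ln n%:R) `<=` a /\
  a `<=` B (n%:R + C_O * Num.sqrt n%:R)).
have mQ (Q' : set G -> Prop) n : measurable [set w | Q' (A (V n.+1) w)].
  rewrite -(prednK (V0 n)); exact: (measurable_DLA S_gen X_iid Q').
have bad n : (maxn N1 N2 <= n.+1)%N ->
    (P [set w | Q n.+1 (A (V n.+1) w)] <=
     (2 * expR (- (Num.min 1 (K / 2) * n.+1%:R)))%:E)%E.
  rewrite geq_max => /andP[/inner[rn in_le] /outer[k kC out_le]].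
  have Bk : B (n.+1 + k)%:R `<=` B (n.+1%:R + C_O * Num.sqrt n.+1%:R).
    by apply: (hitting_ball_sub mu_law S_gen Y_iid); rewrite natrD lerD2l.
  apply: (@le_trans _ _ (P [set w | ~ (B (n.+1%:R - C_I * ln n.+1%:R) `<=` A (V n.+1) w /\
      A (V n.+1) w `<=` B (n.+1 + k)%:R)])).
    apply: le_measure; rewrite ?inE.
    - exact: mQ.
    - exact: (mQ (fun a => ~ (_ `<=` a /\ a `<=` _))).
    - by move=> w notQ [h1 h2]; apply: notQ; split=> // y /h2; exact: Bk.
  apply: le_trans (DLA_bad_prob mu_law mu_sym S_gen G_exp Y_iid X_iid k rn) _.
  rewrite lee_fin [leRHS]mulr_natl mulr2n; apply: lerD.
    by apply: le_trans in_le _; rewrite ler_expR lerN2 ler_piMl // ge_min lexx.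
  apply: le_trans out_le _; rewrite ler_expR lerN2 ler_wpM2r //.
  by rewrite ge_min lexx orbT.
pose H n := if n is m.+1 then [set w | Q m.+1 (A (V m.+1) w)] else set0.
have := @geometric_Borel_Cantelli _ _ _ P H (Num.min 1 (K / 2)) (maxn N1 N2).+1 _ _ _.
move=> <-.
- congr (P _); apply/seteqP; split=> w [n0 Hn0]; exists n0 => -[|n] // /Hn0 good.
    by move=> /(_ good).
  by move: good; rewrite /H /Q /= => /contrapT.
- by rewrite lt_min ltr01 divr_gt0.
- by case=> [|n] /=; [exact: measurable0|exact: mQ].
- by case=> [|n] // Nn; apply: bad; exact: ltnW.
Qed.
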